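(* Let $k\ge 2$ and let $\partial u/\partial t=F(u,\partial u/\partial x,\dots,\partial^k u/\partial x^k)$ be a $k$-th order evolution equation describing $\eta$ pseudo-spherical surfaces with associated $1$-forms $\omega_i=f_{i1}dx+f_{i2}dt$, $1\le i\le 3$, as in the context (so $f_{21}=\eta$). (1) If the equation, with its associated $1$-forms, is not of the exceptional form $$\frac{\partial u}{\partial t}=\frac{1}{f_{11,u}}\Big(\sum_{i=0}^{k-1} f_{12,\partial^i u/\partial x^i}\,\frac{\partial^{i+1}u}{\partial x^{i+1}}-\varepsilon(\beta f_{11}-\eta f_{12})\Big),\qquad f_{11,u}\ne 0,\quad f_{12,\partial^{k-1}u/\partial x^{k-1}}\ne 0,$$ with $\varepsilon\in\{1,-1\}$ and $\beta\in\mathbb R$ constant, where $f_{31}=\varepsilon f_{11}$, $f_{32}=\varepsilon f_{12}$, $f_{22}=\beta$, then there are no local isometric immersions into $\mathbb R^3$ of the surfaces associated to its solutions $u$ whose second fundamental form coefficients $a,b,c$ depend on a jet of finite order of $u$. (2) If the equation is of the exceptional form, then for local isometric immersions of the surfaces determined by its solutions whose coefficients $a,b,c$ depend on a jet of finite order of $u$, the coefficients $a,b,c$ are universal: they are functions of $\eta x+\beta t$ only, independent of $u$.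
   Context: Notation: $z_i=\partial^i u/\partial x^i$ ($z_0=u$), so the evolution equation reads $z_{0,t}=F(z_0,\dots,z_k)$, with $F$ smooth on a connected open set $V\subset\mathbb R^{k+1}$ and $F_{z_k}\neq 0$. Subscripts after a comma denote partial derivatives. ''$\neq 0$'' for a function means nonvanishing at every point of the domain, ''$=0$'' means identically zero; domains are shrunk if necessary. Equations describing $\eta$ pseudo-spherical surfaces (Chern-Tenenblat framework): $\eta$ is a nonzero real parameter (fixed here), and there are smooth functions $f_{ij}$ ($1\le i\le3$, $1\le j\le 2$) of $(z_0,\dots,z_k)\in V$ with $f_{21}=\eta$ such that the $1$-forms $\omega_i=f_{i1}dx+f_{i2}dt$ satisfy $$d\omega_1=\omega_3\wedge\omega_2,\quad d\omega_2=\omega_1\wedge\omega_3,\quad d\omega_3=\omega_1\wedge\omega_2\ne 0$$ if and only if $u$ is a solution of the equation. By Chern and Tenenblat this is equivalent to the following conditions, which may be taken as the definition: $f_{11},f_{31}$ depend only on $z_0$; $f_{12},f_{32}$ do not depend on $z_k$; $f_{22}$ does not depend on $z_{k-1},z_k$; $f_{11,z_0}^2+f_{31,z_0}^2\neq 0$; $f_{11}f_{22}-\eta f_{12}\ne 0$; and $$f_{11,z_0}F=\sum_{i=0}^{k-1}f_{12,z_i}z_{i+1}+\eta f_{32}-f_{31}f_{22},$$ $$\sum_{i=0}^{k-2}f_{22,z_i}z_{i+1}=f_{11}f_{32}-f_{31}f_{12},$$ $$f_{31,z_0}F=\sum_{i=0}^{k-1}f_{32,z_i}z_{i+1}+\eta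 f_{12}-f_{11}f_{22}.$$ A solution $u$ then defines the metric $ds^2=\omega_1^2+\omega_2^2$ of curvature $-1$, with connection form $\omega_3=\omega_{12}$. Let $H=f_{11}f_{11,z_0}-f_{31}f_{31,z_0}$ and $L=f_{11}f_{31,z_0}-f_{31}f_{11,z_0}$. Following the Chern-Tenenblat classification, it is assumed throughout that (on the domain considered) the equation with its $1$-forms is in one of five groups: (I) $L=0$, $f_{31}=\lambda f_{11}\ne0$ with $\lambda^2=1$ (in which case $f_{22}$ is constant and $f_{32}=\lambda f_{12}$); (II) $L=0$, $f_{31}=\lambda f_{11}\neq0$ with $\lambda$ constant, $\lambda^2\ne1$; (III) $L=0$, $H\ne 0$ with either $f_{11}=0$, $f_{31,z_0}\neq 0$ or $f_{31}=0$, $f_{11,z_0}\ne0$; (IV) $L\ne 0$, $H=0$, i.e. $f_{31}^2-f_{11}^2=C$ a nonzero constant; (V) $HL\ne0$. The exceptional form of the claim is the form of the equations of group (I), with $\varepsilon=\lambda$, $\beta=f_{22}$. Second fundamental form: the coefficients $a,b,c$ of a local isometric immersion of the metric $ds^2$ into $\mathbb R^3$ are defined by $\omega_{13}=a\omega_1+b\omega_2$, $\omega_{23}=b\omega_1+c\omega_2$. They are characterized by the Codazzi equations $d\omega_{13}=\omega_{12}\wedge\omega_{23}$, $d\omega_{23}=\omega_{21}\wedge\omega_{13}$ and the Gauss equation, i.e. by $$f_{11}D_ta+f_{21}D_tb-f_{12}D_xa-f_{22}D_xb-2b\Delta_{13}+(a-c)\Delta_{23}=0,$$ $$f_{11}D_tb+f_{21}D_tc-f_{12}D_xb-f_{22}D_xc+(a-c)\Delta_{13}+2b\Delta_{23}=0,$$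 $$ac-b^2=-1,$$ where $\Delta_{13}=f_{11}f_{32}-f_{31}f_{12}$, $\Delta_{23}=f_{21}f_{32}-f_{31}f_{22}$. ''The coefficients depend on a jet of finite order of $u$'' means: for some finite $m$ (without loss of generality $m\ge k$), $a,b,c$ are smooth functions of $(x,t,z_0,\dots,z_m)$ on a set $\Omega\times V_m$, with $\Omega\subset\mathbb R^2$ and $V_m\subset\mathbb R^{m+1}$ nonempty, connected and open, $V_m$ projecting into $V$ on the first $k+1$ coordinates, and satisfy the three equations above identically in $(x,t,z_0,\dots,z_m)\in\Omega\times V_m$ and all further real variables $z_{m+1},z_{m+2},\dots$, where $$D_x=\partial_x+\sum_i z_{i+1}\partial_{z_i},\qquad D_t=\partial_t+\sum_i (D_x^iF)\,\partial_{z_i}.$$ The coefficients are universal if they depend on $x,t$ only. *)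

(* Defs.v *)
From HB Require Import structures.
From mathcomp Require Import all_boot all_order all_algebra.
From mathcomp Require Import all_classical all_reals all_analysis.

Set Implicit Arguments.
Unset Strict Implicit.
Unset Printing Implicit Defensive.
Import Order.TTheory GRing.Theory Num.Theory.
Import numFieldNormedType.Exports.
Local Open Scope classical_set_scope.
Local Open Scope ring_scope.

(* C^n on U, meant for U open and E finite-dimensional: f is C^(n+1) when it is
   Frechet differentiable on U and all its directional derivatives are C^n. *)
Fixpoint Cn_on (R : realType) (E : normedModType R) (n : nat) (U : set E)
    (f : E -> R) : Prop :=
  if n is n'.+1 then
    (forall p, U p -> differentiable f p) /\
    (forall v : E, Cn_on n' U ('D_v f))
  else forall p, U p -> {for p, continuous f}.

Definition smooth_on (R : realType) (E : normedModType R) (U : set E)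
    (f : E -> R) : Prop :=
  forall n, Cn_on n U f.

(* Coordinates z_0, ..., z_k of a row of length k+1, and the corresponding
   partial derivatives; both are used only for i <= k, where [inord i] is i. *)
Definition zc (R : realType) (k : nat) (z : 'rV[R]_k.+1) (i : nat) : R :=
  z 0 (inord i).

Definition pd (R : realType) (k : nat) (i : nat) (f : 'rV[R]_k.+1 -> R) :
    'rV[R]_k.+1 -> R :=
  'D_(delta_mx 0 (inord i)) f.

(* On V, the value of f is determined by z_0, ..., z_(n-1). *)
Definition depends_on_first (R : realType) (k n : nat) (V : set 'rV[R]_k.+1)
    (f : 'rV[R]_k.+1 -> R) : Prop :=
  forall z z', V z -> V z' ->
    (forall i, (i < n)%N -> zc z i = zc z' i) -> f z = f z'.

(* The coefficients f_ij of omega_i = f_i1 dx + f_i2 dt, apart from f_21, which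
   is the constant eta and appears below as a separate parameter. *)
Record oneforms (R : realType) (k : nat) := OneForms {
  f11 : 'rV[R]_k.+1 -> R;
  f12 : 'rV[R]_k.+1 -> R;
  f22 : 'rV[R]_k.+1 -> R;
  f31 : 'rV[R]_k.+1 -> R;
  f32 : 'rV[R]_k.+1 -> R
}.

(* sum_(i < n) f_(z_i) z_(i+1) *)
Definition shift_sum (R : realType) (k n : nat) (f : 'rV[R]_k.+1 -> R)
    (z : 'rV[R]_k.+1) : R :=
  \sum_(i < n) pd i f z * zc z i.+1.

(* The equation u_t = F(u, ..., d^k u / dx^k), with F defined on V, describes
   eta pseudo-spherical surfaces with associated 1-forms w. *)
Record describes_pss (R : realType) (k : nat) (eta : R)
    (V : set 'rV[R]_k.+1) (F : 'rV[R]_k.+1 -> R) (w : oneforms R k) : Prop := {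
  pss_open : open V;
  pss_connected : connected V;
  pss_smooth_F : smooth_on V F;
  pss_order : forall z, V z -> pd k F z <> 0;
  pss_smooth_f11 : smooth_on V (f11 w);
  pss_smooth_f12 : smooth_on V (f12 w);
  pss_smooth_f22 : smooth_on V (f22 w);
  pss_smooth_f31 : smooth_on V (f31 w);
  pss_smooth_f32 : smooth_on V (f32 w);
  pss_dep_f11 : depends_on_first 1 V (f11 w);
  pss_dep_f31 : depends_on_first 1 V (f31 w);
  pss_dep_f12 : depends_on_first k V (f12 w);
  pss_dep_f32 : depends_on_first k V (f32 w);
  pss_dep_f22 : depends_on_first k.-1 V (f22 w);
  pss_nonconst : forall z, V z ->
    (pd 0 (f11 w) z) ^+ 2 + (pd 0 (f31 w) z) ^+ 2 <> 0;
  pss_nondegenerate : forall z, V z ->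
    f11 w z * f22 w z - eta * f12 w z <> 0;
  pss_eq1 : forall z, V z ->
    pd 0 (f11 w) z * F z =
      shift_sum k (f12 w) z + eta * f32 w z - f31 w z * f22 w z;
  pss_eq2 : forall z, V z ->
    shift_sum k.-1 (f22 w) z = f11 w z * f32 w z - f31 w z * f12 w z;
  pss_eq3 : forall z, V z ->
    pd 0 (f31 w) z * F z =
      shift_sum k (f32 w) z + eta * f12 w z - f11 w z * f22 w z
}.

Definition fH (R : realType) (k : nat) (w : oneforms R k) (z : 'rV[R]_k.+1) : R :=
  f11 w z * pd 0 (f11 w) z - f31 w z * pd 0 (f31 w) z.

Definition fL (R : realType) (k : nat) (w : oneforms R k) (z : 'rV[R]_k.+1) : R :=
  f11 w z * pd 0 (f31 w) z - f31 w z * pd 0 (f11 w) z.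

Definition group_I (R : realType) (k : nat) (V : set 'rV[R]_k.+1)
    (w : oneforms R k) : Prop :=
  exists lambda : R, lambda ^+ 2 = 1 /\
    forall z, V z ->
      [/\ fL w z = 0, f31 w z = lambda * f11 w z & lambda * f11 w z <> 0].

Definition group_II (R : realType) (k : nat) (V : set 'rV[R]_k.+1)
    (w : oneforms R k) : Prop :=
  exists lambda : R, lambda ^+ 2 <> 1 /\
    forall z, V z ->
      [/\ fL w z = 0, f31 w z = lambda * f11 w z & lambda * f11 w z <> 0].

Definition group_III (R : realType) (k : nat) (V : set 'rV[R]_k.+1)
    (w : oneforms R k) : Prop :=
  (forall z, V z -> fL w z = 0 /\ fH w z <> 0) /\
  ((forall z, V z -> f11 w z = 0 /\ pd 0 (f31 w) z <> 0) \/
   (forall z, V z -> f31 w z = 0 /\ pd 0 (f11 w) z <> 0)).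

(* V being connected, these conditions amount to L <> 0 together with
   f31^2 - f11^2 being a nonzero constant. *)
Definition group_IV (R : realType) (k : nat) (V : set 'rV[R]_k.+1)
    (w : oneforms R k) : Prop :=
  forall z, V z -> fL w z <> 0 /\ fH w z = 0.

Definition group_V (R : realType) (k : nat) (V : set 'rV[R]_k.+1)
    (w : oneforms R k) : Prop :=
  forall z, V z -> fH w z * fL w z <> 0.

Definition classified (R : realType) (k : nat) (V : set 'rV[R]_k.+1)
    (w : oneforms R k) : Prop :=
  group_I V w \/ group_II V w \/ group_III V w \/ group_IV V w \/ group_V V w.

Definition exceptional (R : realType) (k : nat) (eta : R)
    (V : set 'rV[R]_k.+1) (F : 'rV[R]_k.+1 -> R) (w : oneforms R k)
    (eps beta : R) : Prop :=
  (eps = 1 \/ eps = -1) /\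
  forall z, V z ->
    [/\ pd 0 (f11 w) z <> 0,
        pd k.-1 (f12 w) z <> 0,
        [/\ f31 w z = eps * f11 w z, f32 w z = eps * f12 w z & f22 w z = beta] &
        F z = (pd 0 (f11 w) z)^-1 *
                (shift_sum k (f12 w) z
                 - eps * (beta * f11 w z - eta * f12 w z))].

(* Functions of x, t and of all the jet variables z_0, z_1, ... *)
Definition jetfun (R : realType) := R -> R -> (nat -> R) -> R.

Definition trunc (R : realType) (m : nat) (z : nat -> R) : 'rV[R]_m.+1 :=
  \row_(i < m.+1) z i.

Definition jet_of_z (R : realType) (k : nat) (f : 'rV[R]_k.+1 -> R) : jetfun R :=
  fun x t z => f (trunc k z).

Definition jet_of_xtz (R : realType) (m : nat)
    (a : R * R * 'rV[R]_m.+1 -> R) : jetfun R :=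
  fun x t z => a ((x, t), trunc m z).

Definition dx (R : realType) (g : jetfun R) : jetfun R :=
  fun x t z => derive1 (fun s : R => g s t z) x.

Definition dt (R : realType) (g : jetfun R) : jetfun R :=
  fun x t z => derive1 (fun s : R => g x s z) t.

Definition dz (R : realType) (i : nat) (g : jetfun R) : jetfun R :=
  fun x t z => derive1 (fun s : R => g x t [eta z with i |-> s]) (z i).

(* The sums over nat in Dx and Dt are sums over the support of the summand,
   which is finite whenever g depends on finitely many of the z_i. *)
Definition Dx (R : realType) (g : jetfun R) : jetfun R :=
  fun x t z => dx g x t z + \sum_(i \in [set: nat]) (z i.+1 * dz i g x t z).

Definition Dt (R : realType) (F g : jetfun R) : jetfun R :=
  fun x t z =>
    dt g x t z + \sum_(i \in [set: nat]) (iter i (@Dx R) F x t z * dz i g x t z).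

Definition Delta13 (R : realType) (k : nat) (w : oneforms R k)
    (z : 'rV[R]_k.+1) : R :=
  f11 w z * f32 w z - f31 w z * f12 w z.

Definition Delta23 (R : realType) (k : nat) (eta : R) (w : oneforms R k)
    (z : 'rV[R]_k.+1) : R :=
  eta * f32 w z - f31 w z * f22 w z.

Definition codazzi_gauss (R : realType) (k : nat) (eta : R)
    (F : 'rV[R]_k.+1 -> R) (w : oneforms R k) (a b c : jetfun R)
    (x t : R) (z : nat -> R) : Prop :=
  let zk := trunc k z in
  let DX g := Dx g x t z in
  let DT g := Dt (jet_of_z F) g x t z in
  let A := a x t z in
  let B := b x t z in
  let C := c x t z in
  [/\ f11 w zk * DT a + eta * DT b - f12 w zk * DX a - f22 w zk * DX b
        - 2 * B * Delta13 w zk + (A - C) * Delta23 eta w zk = 0,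
      f11 w zk * DT b + eta * DT c - f12 w zk * DX b - f22 w zk * DX c
        + (A - C) * Delta13 w zk + 2 * B * Delta23 eta w zk = 0 &
      A * C - B ^+ 2 = -1].

(* a, b, c, functions of (x, t, z_0, ..., z_m) on Omega x Vm, are the second
   fundamental form coefficients of local isometric immersions into R^3 of the
   surfaces determined by the solutions u, evaluated on the m-jet of u. *)
Record finite_jet_immersion (R : realType) (k : nat) (eta : R)
    (V : set 'rV[R]_k.+1) (F : 'rV[R]_k.+1 -> R) (w : oneforms R k)
    (m : nat) (Omega : set (R * R)) (Vm : set 'rV[R]_m.+1)
    (a b c : R * R * 'rV[R]_m.+1 -> R) : Prop := {
  imm_order : (k <= m)%N;
  imm_Omega_nonempty : Omega !=set0;
  imm_Omega_open : open Omega;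
  imm_Omega_connected : connected Omega;
  imm_Vm_nonempty : Vm !=set0;
  imm_Vm_open : open Vm;
  imm_Vm_connected : connected Vm;
  imm_Vm_proj : forall z : nat -> R, Vm (trunc m z) -> V (trunc k z);
  imm_smooth_a : smooth_on (Omega `*` Vm) a;
  imm_smooth_b : smooth_on (Omega `*` Vm) b;
  imm_smooth_c : smooth_on (Omega `*` Vm) c;
  imm_eqs : forall (x t : R) (z : nat -> R),
    Omega (x, t) -> Vm (trunc m z) ->
    codazzi_gauss eta F w (jet_of_xtz a) (jet_of_xtz b) (jet_of_xtz c) x t z
}.

(* Main.v *)
Require Import Defs.
From HB Require Import structures.
From mathcomp Require Import all_boot all_order all_algebra.
From mathcomp Require Import all_classical all_reals all_analysis.
From mathcomp Require Import ring lra zify.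
Set Implicit Arguments.
Unset Strict Implicit.
Unset Printing Implicit Defensive.
Import Order.TTheory GRing.Theory Num.Theory.
Import numFieldNormedType.Exports.
Local Open Scope classical_set_scope.
Local Open Scope ring_scope.

(* Let Q = a f_11^2 + 2 eta b f_11 + eta^2 c, the second fundamental form in the
   direction d/dx.  If a, b, c depend on z_0, ..., z_l only, the coefficient of
   z_(k+l) in the Codazzi equations and the z_l-derivative of the Gauss equation
   give Q a_(z_l) = 0, so by descending induction on l the coefficients are locally
   universal where Q <> 0.  Moreover Q cannot vanish on an open set: then
   f_11 a + eta b = +-eta, the Codazzi equations express a as a function that
   depends effectively on a top variable z_j, with j = k or k-1, and the
   coefficient of z_(j+1) in the first of them is a nonzero multiple of a_(z_j).

   For universal coefficients, the coefficient of z_(k-1) in the Codazzi equations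
   forces f_31 = lambda f_11 - mu with lambda, mu constant, and the coefficient of
   z_(k-2) (for k = 2, a separate argument on the x-dependence of a, b, c) forces
   lambda^2 = 1 and mu = 0.  This excludes groups II-V; in group I,
   g = f_32 - lambda f_12 satisfies D_x g = lambda eta g, so g = 0 and f_22 is
   constant.

   In the exceptional form, with s = eta x + beta t, both b exp(-2 eps s) and
   (a^2 + b^2 + 1) exp(-2 eps s) are constant on Omega, and a has no zero.  These
   first integrals make a, b, c global functions of s although Omega is only
   connected: its intersections with the lines s = const need not be. *)

(** * Calculus on sequences of jet variables *)

(** The Codazzi equations contain [D_x^i F] for all i up to m, hence variables beyond z_m. Functions
    are therefore taken on sequences [nat -> R] and varied in one coordinate at a time. In the
    equations that contain jet derivatives of a, b, c, coefficients are compared by evaluating at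
    two points that differ in one coordinate, so no second derivatives of a, b, c occur.

    The obstacle is locality. A vanishing partial derivative makes a function independent of a
    variable only where the slices of the domain are connected, and Q <> 0 can be secured only on a
    dense open set. Local statements are therefore proved on boxes. In the exceptional form, what
    must hold on all of [Omega x Vm] is first put as an equation between first derivatives: such an
    equation is a closed condition and extends from the dense set by continuity. Connectedness of
    [Omega] and [Vm] enters after that, through locally constant functions. *)

Section OneVariable.
Context {R : realType}.
Implicit Types f g : R -> R.

Lemma derive1_near f g (x : R) :
  (\forall s \near x, f s = g s) -> derive1 f x = derive1 g x.
Proof. by move=> fg; rewrite !derive1E; apply: near_eq_derive. Qed.

Lemma is_derive_derive1 f (x : R) :
  derivable f x 1 -> is_derive x 1 f (derive1 f x).
Proof. by move=> df; rewrite derive1E; apply: derivableP. Qed.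

Lemma derive1_is_derive f (x d : R) : is_derive x 1 f d -> derive1 f x = d.
Proof. by move=> df; rewrite derive1E; apply: derive_val. Qed.

Lemma derive1_0_const f (c r x y : R) :
  (forall s, `|s - c| < r -> derivable f s 1 /\ derive1 f s = 0) ->
  `|x - c| < r -> `|y - c| < r -> f x = f y.
Proof.
move=> df.
wlog xy : x y / x <= y.
  by move=> wl hx hy; case: (leP x y) => [|/ltW] xy; [|symmetry]; apply: wl.
move=> hx hy; have inr s : s \in `[x, y] -> `|s - c| < r.
  rewrite in_itv /= => /andP[xs sy]; move: hx hy; rewrite !ltr_norml.
  by move=> /andP[h1 h2] /andP[h3 h4]; apply/andP; split; lra.
move: xy; rewrite le_eqVlt => /orP[/eqP->//|xy].
have := @MVT R f (derive1 f) x y xy.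
case.
- move=> s sxy; apply: is_derive_derive1; apply: (df s _).1; apply: inr.
  by apply: subset_itv_oo_cc.
- apply: derivable_within_continuous => s sxy; apply: (df s _).1; exact: inr.
move=> s sxy; rewrite (df s _).2 ?mul0r; last by apply: inr; exact: subset_itv_oo_cc.
by move/eqP; rewrite subr_eq0 => /eqP.
Qed.

Lemma near_neq0 f (x : R) : derivable f x 1 -> f x != 0 ->
  \forall s \near x, f s != 0.
Proof.
move=> /derivable1_diffP/differentiable_continuous cf fx.
exact: (cvgr_neq0 _ cf fx).
Qed.

Lemma near_lt_dist (x c r : R) : `|x - c| < r -> \forall s \near x, `|s - c| < r.
Proof.
move=> h; have : open [set s : R | `|s - c| < r].
  have -> : [set s : R | `|s - c| < r] = ball c r.
    by rewrite predeqE => s; rewrite /ball /= distrC.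
  exact: ball_open.
by rewrite openE => /(_ x h).
Qed.

Lemma near_exists_neq (P : R -> Prop) (x : R) :
  (\forall s \near x, P s) -> exists2 s, s != x & P s.
Proof.
move=> /nbhs_ballP[e /= e0 he]; exists (x + e / 2).
  by rewrite -subr_eq0 addrC addKr mulf_neq0 ?invr_eq0 ?pnatr_eq0 ?gt_eqF.
by apply: he; rewrite /ball /= opprD addrA subrr add0r normrN gtr0_norm; lra.
Qed.

End OneVariable.

Section Coordinates.
Context {R : realType}.
Implicit Types (f g : (nat -> R) -> R) (z : nat -> R) (U : set (nat -> R)).

Definition upd z (i : nat) (s : R) : nat -> R := [eta z with i |-> s].

Lemma upd_eq z i s : upd z i s i = s.
Proof. by rewrite /upd /= eqxx. Qed.

Lemma upd_neq z i s j : j != i -> upd z i s j = z j.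
Proof. by rewrite /upd /= => /negbTE->. Qed.

Lemma upd_id z i : upd z i (z i) = z.
Proof. by apply/funext => j; rewrite /upd /=; case: eqP => [->|]. Qed.

Lemma upd_upd z i s s' : upd (upd z i s) i s' = upd z i s'.
Proof. by apply/funext => j; rewrite /upd /=; case: eqP. Qed.

Definition par (i : nat) f z : R := derive1 (fun s => f (upd z i s)) (z i).

Definition pdiff (i : nat) f z : Prop := derivable (fun s => f (upd z i s)) (z i) 1.

(** Openness along coordinate lines is what partial derivatives require; no topology on [nat -> R]
    enters. *)
Definition copen U := forall z, U z -> forall i, \forall s \near z i, U (upd z i s).

Definition dep n U f := forall z z', U z -> U z' ->
  (forall i, (i < n)%N -> z i = z' i) -> f z = f z'.

Lemma agree_le n n' z z' : (n' <= n)%N -> (forall i, (i < n)%N -> z i = z' i) ->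
  forall i, (i < n')%N -> z i = z' i.
Proof. by move=> nn' zz i /leq_trans/(_ nn')/zz. Qed.

Lemma dep_sub n U U' f : U' `<=` U -> dep n U f -> dep n U' f.
Proof. by move=> UU df z z' /UU Uz /UU Uz'; apply: df. Qed.

Lemma dep_upd n U f z j s : dep n U f -> (n <= j)%N -> U z -> U (upd z j s) ->
  f (upd z j s) = f z.
Proof.
move=> df nj Uz Uz'; apply: df => // i lin; rewrite upd_neq //.
by rewrite neq_ltn (leq_trans lin nj).
Qed.

Lemma par_near i f g z z' : z i = z' i ->
  (\forall s \near z i, f (upd z i s) = g (upd z' i s)) -> par i f z = par i g z'.
Proof. by move=> zz fg; rewrite /par -zz; apply: derive1_near. Qed.

Lemma par_dep0 n U f i z : copen U -> dep n U f -> (n <= i)%N -> U z ->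
  par i f z = 0.
Proof.
move=> oU df ni Uz; rewrite /par.
rewrite (@derive1_near _ _ (cst (f z))) ?derive1_cst //.
by near=> s; apply: (dep_upd df) => //; near: s; apply: oU.
Unshelve. all: by end_near. Qed.

Lemma par_dep n U f i : copen U -> dep n U f -> dep n U (par i f).
Proof.
move=> oU df z z' Uz Uz' h; case: (ltnP i n) => ni; last first.
  by rewrite !(par_dep0 oU df ni).
have oz := oU z Uz i; have oz' := oU z' Uz' i; rewrite -(h _ ni) in oz'.
apply: par_near; first exact: h.
near=> s; apply: df.
- by near: s.
- by near: s.
- by move=> j jn; rewrite /upd /=; case: eqP => // _; apply: h.
Unshelve. all: by end_near. Qed.

Lemma pdiff_upd i f z s :
  derivable (fun s => f (upd z i s)) s 1 <-> pdiff i f (upd z i s).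
Proof.
rewrite /pdiff upd_eq.
suff -> : (fun s0 => f (upd (upd z i s) i s0)) = fun s0 => f (upd z i s0) by [].
by apply/funext => s'; rewrite upd_upd.
Qed.

Lemma par_upd i f z s : par i f (upd z i s) = derive1 (fun s => f (upd z i s)) s.
Proof.
rewrite /par upd_eq; congr derive1.
by apply/funext => s'; rewrite upd_upd.
Qed.

Lemma pdiffP i f z : pdiff i f z ->
  is_derive (z i) 1 (fun s => f (upd z i s)) (par i f z).
Proof. exact: is_derive_derive1. Qed.

Lemma pdiff_cst i (c : R) z : pdiff i (cst c) z.
Proof. exact: derivable_cst. Qed.

Lemma pdiffD i f g z : pdiff i f z -> pdiff i g z -> pdiff i (fun z => f z + g z) z.
Proof. by move=> df dg; apply: derivableD. Qed.

Lemma pdiffB i f g z : pdiff i f z -> pdiff i g z -> pdiff i (fun z => f z - g z) z.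
Proof. by move=> df dg; apply: derivableB. Qed.

Lemma pdiffM i f g z : pdiff i f z -> pdiff i g z -> pdiff i (fun z => f z * g z) z.
Proof. by move=> df dg; apply: derivableM. Qed.

Lemma pdiff_coord i j z : pdiff i (fun z => z j) z.
Proof.
rewrite /pdiff; case: (eqVneq j i) => [->|ji].
  have -> : (fun s => upd z i s i) = id by apply/funext => s; rewrite upd_eq.
  exact: derivable_id.
have -> : (fun s => upd z i s j) = cst (z j) by apply/funext => s; rewrite upd_neq.
exact: derivable_cst.
Qed.

Lemma par_coord i z : par i (fun z => z i) z = 1.
Proof.
rewrite /par; have -> : (fun s => upd z i s i) = id by apply/funext => s; rewrite upd_eq.
by rewrite derive1_id.
Qed.

Lemma parD i f g z : pdiff i f z -> pdiff i g z ->
  par i (fun z => f z + g z) z = par i f z + par i g z.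
Proof.
move=> /pdiffP df /pdiffP dg; rewrite {1}/par.
exact: (derive1_is_derive (is_deriveD df dg)).
Qed.

Lemma parM i f g z : pdiff i f z -> pdiff i g z ->
  par i (fun z => f z * g z) z = f z * par i g z + g z * par i f z.
Proof.
move=> /pdiffP df /pdiffP dg; rewrite {1}/par.
rewrite (derive1_is_derive (is_deriveM df dg)).
by rewrite !upd_id.
Qed.

Lemma par_cst i (c : R) z : par i (cst c) z = 0.
Proof. by rewrite /par /= derive1_cst. Qed.

Lemma parZ i f (c : R) z : pdiff i f z -> par i (fun z => c * f z) z = c * par i f z.
Proof.
move=> df; rewrite (@parM i (cst c) f) //; last exact: pdiff_cst.
by rewrite par_cst mulr0 addr0.
Qed.

(** Extracts the coefficient of one variable from an equation whose other ingredients are frozen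
    into [c0], ..., [c3]. When fewer than three functions vary, a term with coefficient 0 fills the
    free place. *)
Lemma par_lin3 i z f1 f2 f3 (c0 c1 c2 c3 : R) :
  pdiff i f1 z -> pdiff i f2 z -> pdiff i f3 z ->
  (\forall s \near z i, c0 + c1 * f1 (upd z i s) + c2 * f2 (upd z i s)
      + c3 * f3 (upd z i s) = 0) ->
  c1 * par i f1 z + c2 * par i f2 z + c3 * par i f3 z = 0.
Proof.
move=> d1 d2 d3 h.
have <- : par i (fun z => c1 * f1 z + c2 * f2 z + c3 * f3 z) z = 0.
  rewrite -(par_cst i (- c0) z); apply: par_near => //.
  by apply: filterS h => s /= hs; apply/eqP; rewrite -addr_eq0 -hs; apply/eqP; ring.
have dZ c f : pdiff i f z -> pdiff i (fun z => c * f z) z.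
  by move=> df; apply: (@pdiffM i (cst c)) => //; exact: pdiff_cst.
have d1' := dZ c1 _ d1; have d2' := dZ c2 _ d2; have d3' := dZ c3 _ d3.
by rewrite (parD (pdiffD d1' d2') d3') (parD d1' d2') !parZ.
Qed.

(** With [J = sh] this is the jet part of [D_x], with [J i = D_x^i F] that of [D_t], on functions of
    z_0, ..., z_(n-1). *)
Definition vfield (n : nat) (J : nat -> (nat -> R) -> R) g z : R :=
  \sum_(i < n) J i z * par i g z.

Definition sh (i : nat) z : R := z i.+1.

(** The terms past l vanish because g depends on z_0, ..., z_l, and the terms below l do not see
    z_j. A single difference thus isolates the derivative of g in its top variable. *)
Lemma vfield_upd n l (J : nat -> (nat -> R) -> R) U g z j s :
  copen U -> dep l.+1 U g -> U z -> U (upd z j s) -> (l < j)%N -> (l < n)%N ->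
  (forall i, (i < l)%N -> J i (upd z j s) = J i z) ->
  vfield n J g (upd z j s) - vfield n J g z =
    (J l (upd z j s) - J l z) * par l g z.
Proof.
move=> oU dg Uz Uz' lj ln hJ; rewrite /vfield -sumrB (bigD1 (Ordinal ln)) //=.
rewrite big1 ?addr0 => [|i].
  by rewrite (dep_upd (par_dep l oU dg) lj) //; ring.
rewrite -val_eqE /= neq_ltn => /orP[] il; last first.
  by rewrite !(par_dep0 oU dg) // !mulr0 subrr.
by rewrite hJ // (dep_upd (par_dep i oU dg) lj) // subrr.
Qed.

Lemma vfield_sh_upd n l U g z s :
  copen U -> dep l.+1 U g -> U z -> U (upd z l.+1 s) -> (l < n)%N ->
  vfield n sh g (upd z l.+1 s) = vfield n sh g z + (s - z l.+1) * par l g z.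
Proof.
move=> oU dg Uz Uz' ln; apply/eqP; rewrite addrC -subr_eq; apply/eqP.
rewrite (vfield_upd oU dg Uz Uz') //; first by rewrite /sh upd_eq.
by move=> i il; rewrite /sh upd_neq // ltn_eqF.
Qed.

Lemma vfield_dep_trunc n l (J : nat -> (nat -> R) -> R) U g z :
  copen U -> dep l U g -> U z -> (l <= n)%N -> vfield n J g z = vfield l J g z.
Proof.
move=> oU dg Uz /subnKC <-; rewrite /vfield big_split_ord /= [X in _ + X]big1 ?addr0 //.
by move=> i _; rewrite (par_dep0 oU dg) ?mulr0 // leq_addr.
Qed.

End Coordinates.

Arguments pdiff_coord {R} i j z.
Arguments pdiff_cst {R} i c z.

Section Boxes.
Context {R : realType}.
Implicit Types (f g : (nat -> R) -> R) (z : nat -> R).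

(** The variables after z_m are left free, as in the definition of a finite-jet immersion. The
    coordinates vary independently, so every slice is an interval. *)
Definition zbox (m : nat) (z0 : nat -> R) (r : R) : set (nat -> R) :=
  [set z | forall i, (i <= m)%N -> `|z i - z0 i| < r].

Lemma zbox_copen m z0 r : copen (zbox m z0 r).
Proof.
move=> z zK i; case: (leqP i m) => im; last first.
  near=> s; move=> j jm; rewrite upd_neq; first exact: zK.
  by rewrite ltn_eqF // (leq_ltn_trans jm).
have := near_lt_dist (zK _ im); apply: filterS => s hs j jm.
by rewrite /upd /=; case: eqP => [->//|_]; apply: zK.
Unshelve. all: by end_near. Qed.

Lemma zbox_upd m z0 r z z' i : zbox m z0 r z -> zbox m z0 r z' ->
  zbox m z0 r (upd z i (z' i)).
Proof.
by move=> zK zK' j jm; rewrite /upd /=; case: eqP => [<-|_]; [apply: zK'|apply: zK].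
Qed.

Lemma zbox_dep_pred m z0 r l g : dep l.+1 (zbox m z0 r) g ->
  (forall z, zbox m z0 r z -> pdiff l g z /\ par l g z = 0) ->
  dep l (zbox m z0 r) g.
Proof.
move=> dg hg z z' zK zK' zz'.
have -> : g z = g (upd z' l (z l)).
  apply: dg => //; first exact: zbox_upd.
  move=> i; rewrite ltnS leq_eqVlt => /orP[/eqP->|il]; first by rewrite upd_eq.
  by rewrite upd_neq ?zz' // ltn_eqF.
rewrite -{2}(upd_id z' l).
have hd s : (forall i, i = l -> (i <= m)%N -> `|s - z0 i| < r) ->
  derivable (fun s => g (upd z' l s)) s 1 /\ derive1 (fun s => g (upd z' l s)) s = 0.
  move=> hs; rewrite -par_upd; rewrite pdiff_upd; apply: hg => j jm.
  by rewrite /upd /=; case: eqP => [jl|_]; [apply: hs|apply: zK'].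
case: (leqP l m) => lm.
  apply: (@derive1_0_const _ (fun s => g (upd z' l s)) (z0 l) r).
  - by move=> s hs; apply: hd => i ->.
  - exact: zK.
  - exact: zK'.
(* For l > m the box does not restrict z_l, and the interval around [z' l] is made long enough to
   contain [z l]. *)
apply: (@derive1_0_const _ (fun s => g (upd z' l s)) (z' l) (`|z l - z' l| + 1)).
- by move=> s hs; apply: hd => i ->; rewrite leqNgt lm.
- by rewrite ltrDl.
- by rewrite subrr normr0 ltr_wpDl.
Qed.

Lemma zbox_dep0 m z0 r n g : dep n (zbox m z0 r) g ->
  (forall i z, (i < n)%N -> zbox m z0 r z -> pdiff i g z /\ par i g z = 0) ->
  dep 0 (zbox m z0 r) g.
Proof.
elim: n => [//|n IH] dg hg; apply: IH; last by move=> i z iln; apply: hg; exact: ltnW.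
by apply: zbox_dep_pred => // z; apply: hg.
Qed.

(* Comparing the coefficients of z_n, ..., z_1 in D_x g = c g. *)
Lemma zbox_eigen_const m z0 r n g (c : R) : dep n (zbox m z0 r) g ->
  (forall i z, zbox m z0 r z -> pdiff i g z) ->
  (forall z, zbox m z0 r z -> vfield n sh g z = c * g z) ->
  dep 0 (zbox m z0 r) g.
Proof.
move=> dg hg eqg; have oK := @zbox_copen m z0 r.
suff H j : (j <= n)%N -> dep (n - j) (zbox m z0 r) g by rewrite -(subnn n); apply: H.
elim: j => [|j IH] jn; first by rewrite subn0.
have {IH} := IH (ltnW jn); rewrite -subSS subSn //.
set l := (n - j.+1)%N => dgl; have ln : (l < n)%N by rewrite /l; lia.
apply: zbox_dep_pred => // z zK; split; first exact: hg.
have [s sz zK'] := near_exists_neq (oK z zK l.+1).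
have := eqg _ zK'; rewrite (vfield_sh_upd oK dgl zK zK' ln) eqg // (dep_upd dgl) //.
move=> /eqP; rewrite -subr_eq0 addrAC subrr add0r mulf_eq0 subr_eq0 (negbTE sz) /=.
by move/eqP.
Qed.

End Boxes.

(** * The structure equations on sequences *)

Section Lines.
Context {R : realType} {E : normedModType R}.
Implicit Types (g : E -> R) (c : R -> E).

(** An affine line is described by its increments, so that the difference quotients on both sides
    coincide literally. No chain rule is used and g may be arbitrary. *)
Lemma derive1_line g c (s : R) (v : E) : (forall h, c (h + s) = h *: v + c s) ->
  derive1 (g \o c) s = 'D_v g (c s).
Proof.
move=> hc; rewrite /derive1 /derive.
set u := (X in lim (X @ _) = _); set u' := (X in _ = lim (X @ _)).
suff -> : u = u' by [].
by apply/funext => h; rewrite /u /u' /= hc.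
Qed.

Lemma derivable_line g c (s : R) (v : E) : (forall h, c (h + s) = h *: v + c s) ->
  derivable g (c s) v -> derivable (g \o c) s 1.
Proof.
move=> hc; rewrite /derivable.
set u := (X in cvg (X @ _) -> _); set u' := (X in _ -> cvg (X @ _)).
suff -> : u = u' by [].
by apply/funext => h; rewrite /u /u' /= -hc [h%:A]mulr1.
Qed.

Lemma near_line (U : set E) c (s : R) (v : E) : (forall h, c (h + s) = h *: v + c s) ->
  open U -> U (c s) -> \forall x \near s, U (c x).
Proof.
move=> hc oU Us.
have -> : c = fun x => (x - s) *: v + c s.
  by apply/funext => x; rewrite -hc subrK.
have cc : (fun x : R => (x - s) *: v + c s) @ s --> (s - s) *: v + c s.
  apply: cvgD; last exact: cvg_cst.
  by apply: cvgZ; [apply: cvgB; [exact: cvg_id|exact: cvg_cst]|exact: cvg_cst].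
apply: cc; rewrite subrr scale0r add0r.
by move: oU; rewrite openE => /(_ _ Us).
Qed.

Lemma smooth_differentiable (U : set E) g p :
  smooth_on U g -> U p -> differentiable g p.
Proof. by move=> /(_ 1%N)[+ _] => /[apply]. Qed.

Lemma smooth_derive (U : set E) g v : smooth_on U g -> smooth_on U ('D_v g).
Proof. by move=> sg n; case: (sg n.+1) => _; apply. Qed.

End Lines.

Section Truncation.
Context {R : realType} (k : nat).
Implicit Types (f : 'rV[R]_k.+1 -> R) (z : nat -> R) (V : set 'rV[R]_k.+1).

Definition tfun f : (nat -> R) -> R := fun z => f (trunc k z).

Lemma trunc_line z i (h : R) : (i <= k)%N ->
  trunc k (upd z i (h + z i)) = h *: delta_mx 0 (inord i) + trunc k z.
Proof.
move=> ik; apply/rowP => j; rewrite !mxE eqxx /=.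
have -> : (j == inord i) = (j == i :> nat) by rewrite -val_eqE /= inordK.
case: eqVneq => [<-|ji]; first by rewrite upd_eq mulr1.
by rewrite upd_neq // mulr0 add0r.
Qed.

Lemma trunc_out z i (s : R) : (k < i)%N -> trunc k (upd z i s) = trunc k z.
Proof.
move=> ki; apply/rowP => j; rewrite !mxE upd_neq // ltn_eqF //.
by apply: leq_ltn_trans ki; rewrite -ltnS.
Qed.

Lemma trunc_dep U f : dep k.+1 U (tfun f).
Proof.
move=> z z' _ _ h; rewrite /tfun; congr f; apply/rowP => j.
by rewrite !mxE h.
Qed.

Let line z i (h : R) : (i <= k)%N ->
  trunc k (upd z i (h + z i)) = h *: delta_mx 0 (inord i) + trunc k (upd z i (z i)).
Proof. by move=> ik; rewrite trunc_line // upd_id. Qed.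

Lemma par_trunc f i z : (i <= k)%N -> par i (tfun f) z = pd i f (trunc k z).
Proof.
move=> ik.
have := @derive1_line _ _ f (fun s => trunc k (upd z i s)) _ _ (fun h => line z h ik).
by rewrite upd_id.
Qed.

Lemma pdiff_trunc f i z : differentiable f (trunc k z) -> pdiff i (tfun f) z.
Proof.
move=> df; rewrite /pdiff; case: (leqP i k) => ik.
  have := @derivable_line _ _ f (fun s => trunc k (upd z i s)) _ _ (fun h => line z h ik).
  by rewrite upd_id; apply; apply: diff_derivable.
have -> : (fun s => tfun f (upd z i s)) = cst (tfun f z).
  by apply/funext => s; rewrite /tfun trunc_out.
exact: derivable_cst.
Qed.

Lemma copen_trunc V : open V -> copen [set z | V (trunc k z)].
Proof.
move=> oV z Vz i; case: (leqP i k) => ik.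
  apply: (@near_line _ _ V (fun s => trunc k (upd z i s)) _ _ (fun h => line z h ik)) => //.
  by rewrite upd_id.
by near=> s; rewrite /= trunc_out.
Unshelve. all: by end_near. Qed.

Lemma dep_trunc n V f : (n <= k.+1)%N -> depends_on_first n V f ->
  dep n [set z | V (trunc k z)] (tfun f).
Proof.
move=> nk df z z' Vz Vz' h; apply: df => // i ni.
by rewrite /zc !mxE inordK ?h // (leq_trans ni).
Qed.

Lemma shift_sum_trunc n f z : (n <= k)%N ->
  shift_sum n f (trunc k z) = vfield n sh (tfun f) z.
Proof.
move=> nk; rewrite /shift_sum /vfield; apply: eq_bigr => i _.
rewrite par_trunc; last by rewrite (leq_trans _ nk) // ltnW.
by rewrite mulrC /zc mxE /sh inordK // ltnS (leq_trans (ltn_ord i)).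
Qed.

Definition seq_of (y : 'rV[R]_k.+1) : nat -> R :=
  fun i => if (i <= k)%N then y 0 (inord i) else 0.

Lemma seq_ofK y : trunc k (seq_of y) = y.
Proof.
apply/rowP => i; rewrite mxE /seq_of -ltnS ltn_ord; congr (y _ _).
exact: inord_val.
Qed.

Lemma trunc_ball z0 (r : R) z : 0 < r ->
  zbox k z0 r z <-> ball (trunc k z0) r (trunc k z).
Proof.
move=> r0; split => [zK|].
  split=> // i j; rewrite !mxE /ball /= distrC; apply: zK.
  by rewrite -ltnS.
move=> [_ h] i ik; have := h 0 (inord i).
by rewrite !mxE inordK // /ball /= distrC.
Qed.
End Truncation.


(* The order k is n.+2, and f, p, r, h, q stand for f_11, f_12, f_22, f_31, f_32. *)
Record seq_pss (R : realType) (n : nat) (eta : R) (Z : set (nat -> R))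
    (F f p r h q : (nat -> R) -> R) : Prop := SeqPss {
  sp_open : copen Z;
  sp_F : forall i z, Z z -> pdiff i F z;
  sp_f : forall i z, Z z -> pdiff i f z;
  sp_p : forall i z, Z z -> pdiff i p z;
  sp_r : forall i z, Z z -> pdiff i r z;
  sp_h : forall i z, Z z -> pdiff i h z;
  sp_q : forall i z, Z z -> pdiff i q z;
  sp_df : forall i z, Z z -> pdiff i (par 0 f) z;
  sp_depF : dep n.+3 Z F;
  sp_depf : dep 1 Z f;
  sp_depp : dep n.+2 Z p;
  sp_depr : dep n.+1 Z r;
  sp_deph : dep 1 Z h;
  sp_depq : dep n.+2 Z q;
  sp_order : forall z, Z z -> par n.+2 F z != 0;
  sp_nonconst : forall z, Z z -> par 0 f z ^+ 2 + par 0 h z ^+ 2 != 0;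
  sp_nondeg : forall z, Z z -> f z * r z - eta * p z != 0;
  sp_eq1 : forall z, Z z ->
    par 0 f z * F z = vfield n.+2 sh p z + eta * q z - h z * r z;
  sp_eq2 : forall z, Z z -> vfield n.+1 sh r z = f z * q z - h z * p z;
  sp_eq3 : forall z, Z z ->
    par 0 h z * F z = vfield n.+2 sh q z + eta * p z - f z * r z
}.

Lemma describes_pss_seq (R : realType) (n : nat) (eta : R)
    (V : set 'rV[R]_n.+3) (F : 'rV[R]_n.+3 -> R) (w : oneforms R n.+2) :
  describes_pss eta V F w ->
  seq_pss n eta [set z | V (trunc n.+2 z)] (tfun F) (tfun (f11 w)) (tfun (f12 w))
    (tfun (f22 w)) (tfun (f31 w)) (tfun (f32 w)).
Proof.
case=> oV _ sF ord s11 s12 s22 s31 s32 d11 d31 d12 d32 d22 nc nd e1 e2 e3.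
have sd g i z : smooth_on V g -> V (trunc n.+2 z) -> pdiff i (tfun g) z.
  by move=> sg Vz; apply/pdiff_trunc/(smooth_differentiable sg).
have dz g z : V (trunc n.+2 z) -> par 0 (tfun g) z = pd 0 g (trunc n.+2 z).
  by move=> Vz; rewrite par_trunc.
split; try by move=> i z; apply: sd.
- exact: copen_trunc.
- move=> i z Vz; have -> : par 0 (tfun (f11 w)) = tfun (pd 0 (f11 w)).
    by apply/funext => y; rewrite par_trunc.
  by apply: sd => //; apply: smooth_derive.
- exact: trunc_dep.
- exact: dep_trunc.
- exact: dep_trunc.
- by apply: dep_trunc => //; apply: leqW.
- exact: dep_trunc.
- exact: dep_trunc.
- by move=> z Vz; rewrite par_trunc //; apply/eqP/ord.
- by move=> z Vz; rewrite !par_trunc //; apply/eqP/nc.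
- by move=> z Vz; apply/eqP/nd.
- by move=> z Vz; rewrite par_trunc // -shift_sum_trunc //; apply: e1.
- by move=> z Vz; rewrite -shift_sum_trunc //; apply: e2.
- by move=> z Vz; rewrite par_trunc // -shift_sum_trunc //; apply: e3.
Qed.

Section PssFacts.
Context {R : realType} (n : nat) (eta : R) (Z : set (nat -> R)).
Context (F f p r h q : (nat -> R) -> R).
Hypothesis hp : seq_pss n eta Z F f p r h q.
Implicit Type z : nat -> R.

Let oZ := sp_open hp.

Let df0 : dep 1 Z (par 0 f) := par_dep 0 oZ (sp_depf hp).
Let dh0 : dep 1 Z (par 0 h) := par_dep 0 oZ (sp_deph hp).

(** Differentiate the first structure equation in z_k, k = [n.+2]: only F and the last term z_k
    p_(z_(k-1)) of the sum involve z_k. *)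
Lemma sp_par_p z : Z z -> par n.+1 p z = par 0 f z * par n.+2 F z.
Proof.
move=> Zz.
have H : \forall s \near z n.+2,
   (- (vfield n.+2 sh p z - z n.+2 * par n.+1 p z + eta * q z - h z * r z))
    + par 0 f z * F (upd z n.+2 s) + (- par n.+1 p z) * upd z n.+2 s n.+2
    + 0 * F (upd z n.+2 s) = 0.
  near=> s.
  have Zs : Z (upd z n.+2 s) by near: s; apply: oZ.
  have := sp_eq1 hp Zs.
  rewrite (vfield_sh_upd oZ (sp_depp hp)) // (dep_upd (sp_depq hp)) //.
  rewrite (dep_upd (sp_deph hp)) // (dep_upd (sp_depr hp)) // (dep_upd df0) // upd_eq.
  by move=> ->; ring.
have := par_lin3 (sp_F hp Zz) (pdiff_coord n.+2 n.+2 z) (sp_F hp Zz) H.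
by rewrite par_coord => e; apply/eqP; rewrite eq_sym -subr_eq0; apply/eqP; rewrite -e; ring.
Unshelve. all: by end_near. Qed.

Lemma sp_par_q z : Z z -> par n.+1 q z = par 0 h z * par n.+2 F z.
Proof.
move=> Zz.
have H : \forall s \near z n.+2,
   (- (vfield n.+2 sh q z - z n.+2 * par n.+1 q z + eta * p z - f z * r z))
    + par 0 h z * F (upd z n.+2 s) + (- par n.+1 q z) * upd z n.+2 s n.+2
    + 0 * F (upd z n.+2 s) = 0.
  near=> s.
  have Zs : Z (upd z n.+2 s) by near: s; apply: oZ.
  have := sp_eq3 hp Zs.
  rewrite (vfield_sh_upd oZ (sp_depq hp)) // (dep_upd (sp_depp hp)) //.
  rewrite (dep_upd (sp_depf hp)) // (dep_upd (sp_depr hp)) // (dep_upd dh0) // upd_eq.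
  by move=> ->; ring.
have := par_lin3 (sp_F hp Zz) (pdiff_coord n.+2 n.+2 z) (sp_F hp Zz) H.
by rewrite par_coord => e; apply/eqP; rewrite eq_sym -subr_eq0; apply/eqP; rewrite -e; ring.
Unshelve. all: by end_near. Qed.

(** The z_(k-1)-derivative of the second structure equation, with the top derivatives of p and q
    inserted. The right-hand side is L F_(z_k), so f_22 involves z_(k-2) exactly where L <> 0. *)
Lemma sp_par_r z : Z z ->
  par n r z = par n.+2 F z * (f z * par 0 h z - h z * par 0 f z).
Proof.
move=> Zz.
have H : \forall s \near z n.+1,
   (vfield n.+1 sh r z - z n.+1 * par n r z) + par n r z * upd z n.+1 s n.+1
    + (- f z) * q (upd z n.+1 s) + h z * p (upd z n.+1 s) = 0.
  near=> s.
  have Zs : Z (upd z n.+1 s) by near: s; apply: oZ.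
  have := sp_eq2 hp Zs.
  rewrite (vfield_sh_upd oZ (sp_depr hp)) // (dep_upd (sp_deph hp)) //.
  rewrite (dep_upd (sp_depf hp)) // upd_eq => e.
  lra.
have := par_lin3 (pdiff_coord n.+1 n.+1 z) (sp_q hp Zz) (sp_p hp Zz) H.
by rewrite par_coord sp_par_p // sp_par_q // => e; lra.
Unshelve. all: by end_near. Qed.

End PssFacts.

(** * Finite-jet immersions on a box *)

Section GaussDerivative.
Context {R : realType}.
Implicit Types (u v w f : R -> R).

Lemma derive1_gauss u v w (s : R) :
  derivable u s 1 -> derivable v s 1 -> derivable w s 1 ->
  (\forall s \near s, u s * w s - v s ^+ 2 = -1) ->
  derive1 u s * w s + u s * derive1 w s = 2 * v s * derive1 v s.
Proof.
move=> /is_derive_derive1 du /is_derive_derive1 dv /is_derive_derive1 dw h.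
have : derive1 (fun s => u s * w s - v s * v s) s = 0.
  rewrite -(derive1_cst (-1 : R) s); apply: derive1_near.
  by apply: filterS h => x; rewrite expr2.
rewrite (derive1_is_derive (is_deriveB (is_deriveM du dw) (is_deriveM dv dv))).
by rewrite /GRing.scale /= => e; lra.
Qed.

(* f u + eta v is constant, its square being eta^2. *)
Lemma derive1_asymptotic (eta : R) u v w f (s : R) : eta != 0 ->
  derivable u s 1 -> derivable v s 1 -> derivable w s 1 -> derivable f s 1 ->
  (\forall s \near s, u s * w s - v s ^+ 2 = -1) ->
  (\forall s \near s, u s * f s ^+ 2 + 2 * eta * v s * f s + eta ^+ 2 * w s = 0) ->
  eta * derive1 v s + f s * derive1 u s + u s * derive1 f s = 0 /\
  eta ^+ 2 * derive1 w s + derive1 f s * (f s * u s + 2 * eta * v s)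
    + f s * eta * derive1 v s = 0.
Proof.
move=> eta0 /is_derive_derive1 du /is_derive_derive1 dv /is_derive_derive1 dw.
move=> /is_derive_derive1 df hG hQ.
pose y := fun s => f s * u s + v s * eta.
have dy : is_derive s 1 y (f s * derive1 u s + u s * derive1 f s + derive1 v s * eta).
  apply: is_derive_eq (is_deriveD (is_deriveM df du)
    (is_deriveM dv (is_derive_cst (eta : R) s 1))) _.
  by rewrite /GRing.scale /=; ring.
have y2 : \forall s \near s, y s * y s = eta ^+ 2.
  apply: filterS2 hG hQ => x e1 e2; rewrite /y.
  have -> : (f x * u x + v x * eta) * (f x * u x + v x * eta) =
    u x * (u x * f x ^+ 2 + 2 * eta * v x * f x + eta ^+ 2 * w x)
    - eta ^+ 2 * (u x * w x - v x ^+ 2) by ring.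
  by rewrite e1 e2; ring.
have y0 : y s != 0.
  apply/eqP => ys; have := nbhs_singleton y2.
  by rewrite ys mul0r => /eqP; rewrite eq_sym expf_eq0 (negbTE eta0).
have y' : f s * derive1 u s + u s * derive1 f s + derive1 v s * eta = 0.
  have : derive1 (fun s => y s * y s) s = 0.
    rewrite -(derive1_cst (eta ^+ 2 : R) s); exact: derive1_near.
  rewrite (derive1_is_derive (is_deriveM dy dy)) /GRing.scale /= => e.
  by apply: (mulfI y0); rewrite mulr0; lra.
split; first by rewrite -y'; ring.
have := derive1_near hQ; rewrite derive1_cst.
have -> : (fun s => u s * f s ^+ 2 + 2 * eta * v s * f s + eta ^+ 2 * w s) =
          (fun s => u s * (f s * f s) + ((2 * eta) * v s) * f s + eta ^+ 2 * w s).
  by apply/funext => x; rewrite expr2.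
rewrite (derive1_is_derive (is_deriveD (is_deriveD (is_deriveM du (is_deriveM df df))
  (is_deriveM (is_deriveM (is_derive_cst (2 * eta : R) s 1) dv) df))
  (is_deriveM (is_derive_cst (eta ^+ 2 : R) s 1) dw))) /GRing.scale /= => e.
have {}e : u s * (f s * derive1 f s + f s * derive1 f s) + f s * f s * derive1 u s
  + (2 * eta * v s * derive1 f s + f s * (2 * eta * derive1 v s + v s * 0))
  + (eta ^+ 2 * derive1 w s + w s * 0) = 0 := e.
have y'f := congr1 ( *%R (f s)) y'; lra.
Qed.

End GaussDerivative.

(** [fx] and [ft] stand for D_x f and D_t f. The hypotheses on [bt] and [ct] remove all
    t-derivatives of a, b, c from the Codazzi equations, since f at_ + eta bt = - a ft and f bt +
    eta ct has no second-form derivative left. There remain one equation for [ax] and one purely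
    algebraic relation. *)
Lemma asymptotic_codazzi (R : realType)
    (eta f h p r q fx ft a b c ax at_ bx bt cx ct : R) : eta != 0 ->
  a * f ^+ 2 + 2 * eta * b * f + eta ^+ 2 * c = 0 ->
  eta * bx + f * ax + a * fx = 0 ->
  eta * bt + f * at_ + a * ft = 0 ->
  eta ^+ 2 * cx + fx * (f * a + 2 * eta * b) + f * eta * bx = 0 ->
  eta ^+ 2 * ct + ft * (f * a + 2 * eta * b) + f * eta * bt = 0 ->
  f * at_ + eta * bt - p * ax - r * bx - 2 * b * (f * q - h * p)
    + (a - c) * (eta * q - h * r) = 0 ->
  f * bt + eta * ct - p * bx - r * cx + (a - c) * (f * q - h * p)
    + 2 * b * (eta * q - h * r) = 0 ->
  (f * r - eta * p) * ax = eta * a * ft - r * a * fx + 2 * eta * b * (f * q - h * p)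
    - eta * (a - c) * (eta * q - h * r) /\
  a * ((f * r - eta * p) * ((eta ^+ 2 + f ^+ 2) * h - eta * fx)) =
    (f * a + eta * b) *
    (2 * (eta ^+ 2 * ft - eta * r * fx - (eta ^+ 2 + f ^+ 2) * (eta * q - h * r))).
Proof.
move=> eta0 Q Bx Bt Cx Ct E1 E2.
have hbx : bx = - (f * ax + a * fx) / eta.
  by apply: (mulfI eta0); rewrite [RHS]mulrC divfK // -[RHS]addr0 -Bx; ring.
have hbt : bt = - (f * at_ + a * ft) / eta.
  by apply: (mulfI eta0); rewrite [RHS]mulrC divfK // -[RHS]addr0 -Bt; ring.
have eta20 : eta ^+ 2 != 0 by rewrite expf_eq0.
have hcx : cx = - (fx * (f * a + 2 * eta * b) + f * eta * bx) / eta ^+ 2.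
  by apply: (mulfI eta20); rewrite [RHS]mulrC divfK // -[RHS]addr0 -Cx; ring.
have hct : ct = - (ft * (f * a + 2 * eta * b) + f * eta * bt) / eta ^+ 2.
  by apply: (mulfI eta20); rewrite [RHS]mulrC divfK // -[RHS]addr0 -Ct; ring.
have hc : c = - (a * f ^+ 2 + 2 * eta * b * f) / eta ^+ 2.
  by apply: (mulfI eta20); rewrite [RHS]mulrC divfK // -[RHS]addr0 -Q; ring.
split; apply/eqP; rewrite -subr_eq0; apply/eqP.
  by rewrite -(mulr0 eta) -E1 hbt hbx; field.
(* The combination eta^3 E2 + eta^2 f E1 of the Codazzi equations is the one in which [ax] cancels
   as well. *)
have e : eta ^+ 3 * 0 + eta ^+ 2 * f * 0 = 0 :> R by ring.
rewrite -{1}E2 -{1}E1 in e; apply: etrans e.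
by rewrite hct hcx hbt hbx hc; field.
Qed.

Section JetDerivatives.
Context {R : realType} (m : nat) (X T : set R) (K : set (nat -> R)).
Implicit Types (g : jetfun R) (z : nat -> R).

Definition jet_diff g := forall x t z, X x -> T t -> K z ->
  [/\ derivable (fun s => g s t z) x 1, derivable (fun s => g x s z) t 1 &
      forall i, pdiff i (g x t) z].

(** A common form of [D_x] ([vx = 1], [vt = 0]) and [D_t] ([vx = 0], [vt = 1]), so that facts about
    both are proved once. *)
Definition dir (vx vt : R) (J : nat -> (nat -> R) -> R) g x t z : R :=
  vx * dx g x t z + vt * dt g x t z + vfield m.+1 J (g x t) z.

Lemma dx_dep n g x t z z' : open X -> X x -> K z -> K z' ->
  (forall x', X x' -> dep n K (g x' t)) -> (forall i, (i < n)%N -> z i = z' i) ->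
  dx g x t z = dx g x t z'.
Proof.
move=> oX Xx Kz Kz' dg zz; apply: derive1_near.
have : \forall s \near x, X s by move: oX; rewrite openE => /(_ _ Xx).
by apply: filterS => s Xs; apply: dg.
Qed.

Lemma dt_dep n g x t z z' : open T -> T t -> K z -> K z' ->
  (forall t', T t' -> dep n K (g x t')) -> (forall i, (i < n)%N -> z i = z' i) ->
  dt g x t z = dt g x t z'.
Proof.
move=> oT Tt Kz Kz' dg zz; apply: derive1_near.
have : \forall s \near t, T s by move: oT; rewrite openE => /(_ _ Tt).
by apply: filterS => s Ts; apply: dg.
Qed.

Lemma dir_upd vx vt (J : nat -> (nat -> R) -> R) l g x t z j s :
  open X -> open T -> copen K -> X x -> T t -> K z -> K (upd z j s) ->
  (forall x t, X x -> T t -> dep l.+1 K (g x t)) -> (l < j)%N -> (l <= m)%N ->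
  (forall i, (i < l)%N -> J i (upd z j s) = J i z) ->
  dir vx vt J g x t (upd z j s) - dir vx vt J g x t z =
    (J l (upd z j s) - J l z) * par l (g x t) z.
Proof.
move=> oX oT oK Xx Tt Kz Kz' dg lj lm hJ.
have zz i : (i < l.+1)%N -> upd z j s i = z i.
  by move=> il; rewrite upd_neq // ltn_eqF // (leq_trans il).
rewrite -(@vfield_upd _ m.+1 l J K _ _ _ _ oK (dg x t Xx Tt)) // /dir.
rewrite (dx_dep oX Xx Kz' Kz (fun x' Xx' => dg x' t Xx' Tt)) //.
by rewrite (dt_dep oT Tt Kz' Kz (fun t' Tt' => dg x t' Xx Tt')) //; ring.
Qed.

End JetDerivatives.

Definition dX (R : realType) m : jetfun R -> jetfun R := dir m 1 0 sh.
Definition dT (R : realType) m (J : nat -> (nat -> R) -> R) : jetfun R -> jetfun R :=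
  dir m 0 1 J.

(* J i stands for D_x^i F. *)
Record box_imm (R : realType) (n m : nat) (eta : R) (X T : set R) (K : set (nat -> R))
    (F f p r h q : (nat -> R) -> R) (J : nat -> (nat -> R) -> R)
    (a b c : jetfun R) : Prop := BoxImm {
  bi_X : open X;
  bi_T : open T;
  bi_m : (n.+2 <= m)%N;
  bi_J0 : J 0%N = F;
  bi_Jdep : forall i, dep (n.+3 + i) setT (J i);
  bi_Jpar : forall i z, par (n.+2 + i) (J i) z = par n.+2 F z;
  bi_a : jet_diff X T K a;
  bi_b : jet_diff X T K b;
  bi_c : jet_diff X T K c;
  bi_depa : forall x t, X x -> T t -> dep m.+1 K (a x t);
  bi_depb : forall x t, X x -> T t -> dep m.+1 K (b x t);
  bi_depc : forall x t, X x -> T t -> dep m.+1 K (c x t);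
  bi_eq1 : forall x t z, X x -> T t -> K z ->
    f z * dT m J a x t z + eta * dT m J b x t z - p z * dX m a x t z
      - r z * dX m b x t z - 2 * b x t z * (f z * q z - h z * p z)
      + (a x t z - c x t z) * (eta * q z - h z * r z) = 0;
  bi_eq2 : forall x t z, X x -> T t -> K z ->
    f z * dT m J b x t z + eta * dT m J c x t z - p z * dX m b x t z
      - r z * dX m c x t z + (a x t z - c x t z) * (f z * q z - h z * p z)
      + 2 * b x t z * (eta * q z - h z * r z) = 0;
  bi_gauss : forall x t z, X x -> T t -> K z ->
    a x t z * c x t z - b x t z ^+ 2 = -1
}.

Lemma open_near (R : realType) (X : set R) x : open X -> X x -> \forall s \near x, X s.
Proof. by rewrite openE => oX Xx; apply: (oX _ Xx). Qed.

Section LocalImmersion.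
Context {R : realType} (n m : nat) (eta : R) (X T : set R).
Context (z0 : nat -> R) (rho : R) (Z : set (nat -> R)).
Context (F f p r h q : (nat -> R) -> R) (J : nat -> (nat -> R) -> R) (a b c : jetfun R).
Local Notation K := (zbox m z0 rho).
Hypothesis eta0 : eta != 0.
Hypothesis hp : seq_pss n eta Z F f p r h q.
Hypothesis hKZ : K `<=` Z.
Hypothesis hi : box_imm n m eta X T K F f p r h q J a b c.

Let oX := bi_X hi.
Let oT := bi_T hi.
Let oK : copen K := @zbox_copen R m z0 rho.
Let depf := dep_sub hKZ (sp_depf hp).
Let deph := dep_sub hKZ (sp_deph hp).
Let depp := dep_sub hKZ (sp_depp hp).
Let depq := dep_sub hKZ (sp_depq hp).
Let depr := dep_sub hKZ (sp_depr hp).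

Lemma bi_par_gauss i x t z : X x -> T t -> K z ->
  par i (a x t) z * c x t z + a x t z * par i (c x t) z =
    2 * b x t z * par i (b x t) z.
Proof.
move=> Xx Tt Kz.
have [_ _ /(_ i) da] := bi_a hi Xx Tt Kz.
have [_ _ /(_ i) db] := bi_b hi Xx Tt Kz.
have [_ _ /(_ i) dc] := bi_c hi Xx Tt Kz.
have := derive1_gauss da db dc; rewrite !upd_id; apply.
near=> s; apply: (bi_gauss hi Xx Tt); near: s; exact: oK.
Unshelve. all: by end_near. Qed.

(** Its top derivative is F_(z_k) <> 0, so [D_x^i F] cannot be locally constant in z_(k+i). Two
    values suffice because the Codazzi equations are subtracted rather than differentiated; this
    covers i = 0 too, where F need not be affine in z_k. *)
Lemma bi_J_nonconst i z : K z -> exists s,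
  K (upd z (n.+2 + i) s) /\ J i (upd z (n.+2 + i) s) != J i z.
Proof.
move=> Kz; apply: contrapT => hn.
have := sp_order hp (hKZ Kz); rewrite -(bi_Jpar hi i z).
have -> : par (n.+2 + i) (J i) z = par (n.+2 + i) (cst (J i z)) z.
  apply: par_near => //; near=> s; apply: contrapT => hs; apply: hn; exists s.
  by split; [near: s; exact: oK|apply/eqP].
by rewrite par_cst eqxx.
Unshelve. all: by end_near. Qed.

(* The coefficient of z_(k+l) in the Codazzi equations. *)
Lemma bi_top_order l x t z : (l <= m)%N -> X x -> T t -> K z ->
  (forall x t, X x -> T t ->
    [/\ dep l.+1 K (a x t), dep l.+1 K (b x t) & dep l.+1 K (c x t)]) ->
  f z * par l (a x t) z + eta * par l (b x t) z = 0 /\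
  f z * par l (b x t) z + eta * par l (c x t) z = 0.
Proof.
move=> lm Xx Tt Kz dabc.
have [s [Kz' Js]] := bi_J_nonconst l Kz.
have da x' t' Xx' Tt' := let: And3 u _ _ := dabc x' t' Xx' Tt' in u.
have db x' t' Xx' Tt' := let: And3 _ u _ := dabc x' t' Xx' Tt' in u.
have dc x' t' Xx' Tt' := let: And3 _ _ u := dabc x' t' Xx' Tt' in u.
have lj : (l < n.+2 + l)%N by lia.
have eX g : (forall x t, X x -> T t -> dep l.+1 K (g x t)) ->
    dX m g x t (upd z (n.+2 + l) s) = dX m g x t z.
  move=> dg; apply/eqP; rewrite -subr_eq0 /dX (dir_upd _ _ oX oT oK Xx Tt Kz Kz' dg) //.
    by rewrite /sh upd_neq ?subrr ?mul0r //; lia.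
  by move=> i il; rewrite /sh upd_neq //; lia.
have eT g : (forall x t, X x -> T t -> dep l.+1 K (g x t)) ->
    dT m J g x t (upd z (n.+2 + l) s) =
    dT m J g x t z + (J l (upd z (n.+2 + l) s) - J l z) * par l (g x t) z.
  move=> dg; apply/eqP; rewrite addrC -subr_eq; apply/eqP.
  rewrite /dT (dir_upd _ _ oX oT oK Xx Tt Kz Kz' dg) // => i il.
  by apply: (dep_upd (bi_Jdep hi (i := i))) => //; lia.
have e1 := bi_eq1 hi Xx Tt Kz; have e1' := bi_eq1 hi Xx Tt Kz'.
have e2 := bi_eq2 hi Xx Tt Kz; have e2' := bi_eq2 hi Xx Tt Kz'.
rewrite !eT // !eX // in e1' e2'.
have kl i : (i <= n.+2)%N -> (i <= n.+2 + l)%N by lia.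
rewrite !(dep_upd depf (kl _ _) Kz Kz') ?(dep_upd deph (kl _ _) Kz Kz')
  ?(dep_upd depp (kl _ _) Kz Kz') ?(dep_upd depq (kl _ _) Kz Kz')
  ?(dep_upd depr (kl _ _) Kz Kz') ?(dep_upd (da x t Xx Tt) lj Kz Kz')
  ?(dep_upd (db x t Xx Tt) lj Kz Kz') ?(dep_upd (dc x t Xx Tt) lj Kz Kz') // in e1' e2'.
set d := (J l _ - J l z) in e1' e2'.
have d0 : d != 0 by rewrite subr_eq0.
by split; apply: (mulfI d0); rewrite mulr0; lra.
Qed.

Lemma bi_universal :
  (forall x t z, X x -> T t -> K z ->
    a x t z * f z ^+ 2 + 2 * eta * b x t z * f z + eta ^+ 2 * c x t z != 0) ->
  forall x t, X x -> T t -> [/\ dep 0 K (a x t), dep 0 K (b x t) & dep 0 K (c x t)].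
Proof.
move=> hQ.
suff H j : (j <= m.+1)%N -> forall x t, X x -> T t ->
    [/\ dep (m.+1 - j) K (a x t), dep (m.+1 - j) K (b x t) & dep (m.+1 - j) K (c x t)].
  by have := H m.+1; rewrite subnn; apply.
elim: j => [|j IH] jm x t Xx Tt.
  rewrite subn0.
  split; [exact: (bi_depa hi Xx Tt)|exact: (bi_depb hi Xx Tt)|exact: (bi_depc hi Xx Tt)].
have {IH} := IH (ltnW jm); rewrite -subSS subSn //.
set l := (m.+1 - j.+1)%N => IH; have lm : (l <= m)%N by rewrite /l; lia.
have H z : K z -> [/\ par l (a x t) z = 0, par l (b x t) z = 0 & par l (c x t) z = 0].
  move=> Kz; have [e1 e2] := bi_top_order lm Xx Tt Kz IH.
  have e3 := bi_par_gauss l Xx Tt Kz.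
  (* By [e1] and [e2] the derivatives of (a, b, c) are proportional to (eta^2, - eta f, f^2);
     inserted into the differentiated Gauss equation [e3], this vector produces Q. *)
  have a0 : par l (a x t) z = 0.
    apply: (mulfI (hQ x t z Xx Tt Kz)); rewrite mulr0.
    have hb : par l (b x t) z = - f z * par l (a x t) z / eta.
      by apply: (mulfI eta0); rewrite [RHS]mulrC divfK //; lra.
    have hc : par l (c x t) z = - f z * par l (b x t) z / eta.
      by apply: (mulfI eta0); rewrite [RHS]mulrC divfK //; lra.
    move/eqP: e3; rewrite -subr_eq0 => /eqP e3.
    by rewrite -(mulr0 (eta ^+ 2)) -e3 hc hb; field.
  have b0 : par l (b x t) z = 0.
    by apply: (mulfI eta0); rewrite mulr0 -e1 a0; ring.
  by split=> //; apply: (mulfI eta0); rewrite mulr0 -e2 b0; ring.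
have [da db dc] := IH x t Xx Tt.
by split; apply: zbox_dep_pred => // z Kz; have [? ? ?] := H z Kz; split => //;
  [have [_ _] := bi_a hi Xx Tt Kz|have [_ _] := bi_b hi Xx Tt Kz
  |have [_ _] := bi_c hi Xx Tt Kz]; apply.
Qed.

End LocalImmersion.

(** * The direction d/dx is not asymptotic *)

Section AsymptoticDirection.
Context {R : realType} (n m : nat) (eta : R) (X T : set R).
Context (z0 : nat -> R) (rho : R) (Z : set (nat -> R)).
Context (F f p r h q : (nat -> R) -> R) (J : nat -> (nat -> R) -> R) (a b c : jetfun R).
Local Notation K := (zbox m z0 rho).
Hypothesis eta0 : eta != 0.
Hypothesis hp : seq_pss n eta Z F f p r h q.
Hypothesis hKZ : K `<=` Z.
Hypothesis hi : box_imm n m eta X T K F f p r h q J a b c.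
Hypothesis hQ : forall x t z, X x -> T t -> K z ->
  a x t z * f z ^+ 2 + 2 * eta * b x t z * f z + eta ^+ 2 * c x t z = 0.

Let oX := bi_X hi.
Let oT := bi_T hi.
Let oK : copen K := @zbox_copen R m z0 rho.
Let depf := dep_sub hKZ (sp_depf hp).
Let deph := dep_sub hKZ (sp_deph hp).
Let depp := dep_sub hKZ (sp_depp hp).
Let depq := dep_sub hKZ (sp_depq hp).
Let depr := dep_sub hKZ (sp_depr hp).
Let depF := dep_sub hKZ (sp_depF hp).
Let depf' : dep 1 K (par 0 f) := par_dep 0 oK depf.

(** [M] is the coefficient of omega_1 /\ omega_2 in dx /\ dt, hence nonzero. [W] is, up to sign and
    a positive factor, the geodesic curvature of the lines t = const. [y] and [S] are the other
    factors of the algebraic relation a M W = 2 y S of [asymptotic_codazzi]. *)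
Local Notation y := (fun x t z => f z * a x t z + eta * b x t z).
Local Notation M := (fun z => f z * r z - eta * p z).
Local Notation W := (fun z =>
  (eta ^+ 2 + f z * f z) * h z - eta * (par 0 f z * z 1%N)).
Local Notation S := (fun z => eta ^+ 2 * (par 0 f z * F z)
  - eta * r z * (par 0 f z * z 1%N)
  - (eta ^+ 2 + f z * f z) * (eta * q z - h z * r z)).

Let par_asymptotic i x t z : X x -> T t -> K z ->
  eta * par i (b x t) z + f z * par i (a x t) z + a x t z * par i f z = 0 /\
  eta ^+ 2 * par i (c x t) z + par i f z * (f z * a x t z + 2 * eta * b x t z)
    + f z * eta * par i (b x t) z = 0.
Proof.
move=> Xx Tt Kz.
have [_ _ /(_ i) da] := bi_a hi Xx Tt Kz.
have [_ _ /(_ i) db] := bi_b hi Xx Tt Kz.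
have [_ _ /(_ i) dc] := bi_c hi Xx Tt Kz.
have := derive1_asymptotic eta0 da db dc (sp_f hp (i := i) (hKZ Kz)).
rewrite !upd_id; apply.
  by apply: filterS (oK Kz i) => s; apply: (bi_gauss hi Xx Tt).
by apply: filterS (oK Kz i) => s; apply: hQ.
Qed.

Let dx_asymptotic x t z : X x -> T t -> K z ->
  eta * dx b x t z + f z * dx a x t z = 0 /\
  eta ^+ 2 * dx c x t z + f z * eta * dx b x t z = 0.
Proof.
move=> Xx Tt Kz.
have [da _ _] := bi_a hi Xx Tt Kz; have [db _ _] := bi_b hi Xx Tt Kz.
have [dc _ _] := bi_c hi Xx Tt Kz.
have := derive1_asymptotic eta0 da db dc (derivable_cst (f z) x 1).
rewrite derive1_cst mulr0 mul0r !addr0; apply.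
  by apply: filterS (open_near oX Xx) => s Xs; apply: (bi_gauss hi Xs Tt).
by apply: filterS (open_near oX Xx) => s Xs; apply: hQ.
Qed.

Let dt_asymptotic x t z : X x -> T t -> K z ->
  eta * dt b x t z + f z * dt a x t z = 0 /\
  eta ^+ 2 * dt c x t z + f z * eta * dt b x t z = 0.
Proof.
move=> Xx Tt Kz.
have [_ da _] := bi_a hi Xx Tt Kz; have [_ db _] := bi_b hi Xx Tt Kz.
have [_ dc _] := bi_c hi Xx Tt Kz.
have := derive1_asymptotic eta0 da db dc (derivable_cst (f z) t 1).
rewrite derive1_cst mulr0 mul0r !addr0; apply.
  by apply: filterS (open_near oT Tt) => s Ts; apply: (bi_gauss hi Xx Ts).
by apply: filterS (open_near oT Tt) => s Ts; apply: hQ.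
Qed.

Let dir_asymptotic vx vt V x t z : X x -> T t -> K z ->
  eta * dir m vx vt V b x t z + f z * dir m vx vt V a x t z
    + a x t z * (par 0 f z * V 0%N z) = 0 /\
  eta ^+ 2 * dir m vx vt V c x t z
    + par 0 f z * V 0%N z * (f z * a x t z + 2 * eta * b x t z)
    + f z * eta * dir m vx vt V b x t z = 0.
Proof.
move=> Xx Tt Kz.
have -> : par 0 f z * V 0%N z = vfield m.+1 V f z.
  by rewrite (vfield_dep_trunc _ oK depf Kz) // /vfield big_ord1 mulrC.
have [x1 x2] := dx_asymptotic Xx Tt Kz; have [t1 t2] := dt_asymptotic Xx Tt Kz.
have s1 : eta * vfield m.+1 V (b x t) z + f z * vfield m.+1 V (a x t) z
    + a x t z * vfield m.+1 V f z = 0.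
  rewrite /vfield !big_distrr -!big_split big1 //= => i _.
  by have [e _] := par_asymptotic i Xx Tt Kz; rewrite -(mulr0 (V i z)) -e; ring.
have s2 : eta ^+ 2 * vfield m.+1 V (c x t) z
    + vfield m.+1 V f z * (f z * a x t z + 2 * eta * b x t z)
    + f z * eta * vfield m.+1 V (b x t) z = 0.
  rewrite /vfield !big_distrr big_distrl -!big_split big1 //= => i _.
  by have [_ e] := par_asymptotic i Xx Tt Kz; rewrite -(mulr0 (V i z)) -e; ring.
rewrite /dir; split.
  have e : vx * 0 + vt * 0 + 0 = 0 :> R by ring.
  by rewrite -{1}x1 -{1}t1 -{1}s1 in e; apply: etrans e; ring.
have e : vx * 0 + vt * 0 + 0 = 0 :> R by ring.
by rewrite -{1}x2 -{1}t2 -{1}s2 in e; apply: etrans e; ring.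
Qed.

Let codazzi x t z : X x -> T t -> K z ->
  M z * dX m a x t z = eta * a x t z * (par 0 f z * F z)
    - r z * a x t z * (par 0 f z * z 1%N)
    + 2 * eta * b x t z * (f z * q z - h z * p z)
    - eta * (a x t z - c x t z) * (eta * q z - h z * r z) /\
  a x t z * (M z * W z) = 2 * y x t z * S z.
Proof.
move=> Xx Tt Kz.
have [b1 c1] := dir_asymptotic 1 0 sh Xx Tt Kz.
have [b2 c2] := dir_asymptotic 0 1 J Xx Tt Kz; rewrite (bi_J0 hi) in b2 c2.
have [e1 e2] := asymptotic_codazzi eta0 (hQ Xx Tt Kz) b1 b2 c1 c2
  (bi_eq1 hi Xx Tt Kz) (bi_eq2 hi Xx Tt Kz).
split; first exact: e1.
by move: e2; rewrite /sh -expr2 => ->; ring.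
Qed.

Let y_const x t : X x -> T t -> dep 0 K (y x t).
Proof.
move=> Xx Tt; apply: (@zbox_dep0 _ m z0 rho m.+1).
  move=> z z' Kz Kz' zz.
  rewrite (bi_depa hi Xx Tt Kz Kz' zz) (bi_depb hi Xx Tt Kz Kz' zz).
  by rewrite (depf Kz Kz') // => i; rewrite ltnS leqn0 => /eqP ->; apply: zz.
move=> i z _ Kz.
have [_ _ /(_ i) da] := bi_a hi Xx Tt Kz.
have [_ _ /(_ i) db] := bi_b hi Xx Tt Kz.
have df := sp_f hp (i := i) (hKZ Kz).
have d1 := pdiffM df da; have d2 := pdiffM (pdiff_cst i eta z) db.
split; first exact: (pdiffD d1 d2).
rewrite (parD d1 d2) (parM df da) (parM (pdiff_cst i eta z) db) par_cst.
by have [e _] := par_asymptotic i Xx Tt Kz; apply: etrans e => /=; ring.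
Qed.

Let y_neq0 x t z : X x -> T t -> K z -> y x t z != 0.
Proof.
move=> Xx Tt Kz; apply/eqP => y0.
have : y x t z ^+ 2 = a x t z * (a x t z * f z ^+ 2 + 2 * eta * b x t z * f z
    + eta ^+ 2 * c x t z) - eta ^+ 2 * (a x t z * c x t z - b x t z ^+ 2) by ring.
rewrite y0 (hQ Xx Tt Kz) (bi_gauss hi Xx Tt Kz) expr0n mulr0 sub0r mulrN1 opprK.
by move/eqP; rewrite eq_sym expf_eq0 (negbTE eta0).
Qed.

(* a is given by a (f r - eta p) W = 2 y S; as S involves z_j, so does a, and then
   the first Codazzi equation involves z_(j+1). *)
Let no_asymptotic j U x t z : copen U -> U `<=` K -> (n < j <= m)%N ->
  dep j U (fun z => M z * W z) -> dep j.+1 U S ->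
  dep j.+1 U (fun z => par 0 f z * F z) ->
  (forall z, U z -> W z != 0) -> X x -> T t -> U z -> pdiff j S z ->
  par j S z = 0.
Proof.
move=> oU UK /andP[nj jm] dMW dS dfF W0 Xx Tt Uz pS.
have M0 z' : U z' -> M z' != 0 by move=> /UK/hKZ Zz; exact: (sp_nondeg hp Zz).
have df z1 z2 : U z1 -> U z2 -> (forall i, (i < j.+1)%N -> z1 i = z2 i) -> f z1 = f z2.
  move=> U1 U2 zz; apply: depf; [exact: UK|exact: UK|].
  by move=> i; rewrite ltnS leqn0 => /eqP ->; apply: zz.
have da x' t' : X x' -> T t' -> dep j.+1 U (a x' t').
  move=> Xx' Tt' z1 z2 U1 U2 zz.
  have MW0 : M z1 * W z1 != 0 by rewrite mulf_neq0 // ?M0 // W0.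
  apply: (mulIf MW0).
  rewrite {2}(dMW z1 z2 U1 U2) => [|i ij]; last by apply: zz; apply: ltnW.
  rewrite (codazzi Xx' Tt' (UK _ U1)).2 (codazzi Xx' Tt' (UK _ U2)).2.
  by rewrite (dS z1 z2 U1 U2 zz) (y_const Xx' Tt' (UK _ U1) (UK _ U2)).
have db : dep j.+1 U (b x t).
  move=> z1 z2 U1 U2 zz; apply: (mulfI eta0).
  have := y_const Xx Tt (UK _ U1) (UK _ U2) => /(_ _)/=.
  rewrite (da x t Xx Tt z1 z2 U1 U2 zz) (df z1 z2 U1 U2 zz) => e.
  by apply: (addrI (f z2 * a x t z2)); apply: e.
have dc : dep j.+1 U (c x t).
  move=> z1 z2 U1 U2 zz.
  have eta20 : eta ^+ 2 != 0 by rewrite expf_eq0.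
  apply: (mulfI eta20).
  have := hQ Xx Tt (UK _ U1); have := hQ Xx Tt (UK _ U2).
  rewrite (da x t Xx Tt z1 z2 U1 U2 zz) (df z1 z2 U1 U2 zz) (db z1 z2 U1 U2 zz).
  by move=> e1 e2; lra.
have a_j : par j (a x t) z = 0.
  have [s sz Uz'] := near_exists_neq (oU z Uz j.+1).
  have zz i : (i < j.+1)%N -> upd z j.+1 s i = z i by move=> ij; rewrite upd_neq // ltn_eqF.
  have K1 := UK _ Uz; have K2 := UK _ Uz'.
  have [e1 _] := codazzi Xx Tt K1; have [e2 _] := codazzi Xx Tt K2.
  have e : M z * dX m a x t (upd z j.+1 s) = M z * dX m a x t z.
    rewrite e1 -{1}(dep_upd depr (_ : (n.+1 <= j.+1)%N) K1 K2); last by lia.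
    rewrite -{1}(dep_upd depp (_ : (n.+2 <= j.+1)%N) K1 K2) //.
    rewrite -{1}(dep_upd depf (_ : (1 <= j.+1)%N) K1 K2) // e2.
    rewrite (dfF _ _ Uz' Uz zz) (da x t Xx Tt _ _ Uz' Uz zz) (db _ _ Uz' Uz zz).
    rewrite (dc _ _ Uz' Uz zz) (dep_upd depf _ K1 K2) // (dep_upd deph _ K1 K2) //.
    rewrite (dep_upd depp _ K1 K2) // (dep_upd depq _ K1 K2) //.
    rewrite (dep_upd depr _ K1 K2) ?(dep_upd depf' _ K1 K2) //; last by lia.
    by rewrite upd_neq //; lia.
  move/(mulfI (M0 _ Uz))/eqP: e; rewrite -subr_eq0 /dX.
  rewrite (dir_upd 1 0 oX oT oU Xx Tt Uz Uz' da) // => [|i ij].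
    by rewrite /sh upd_eq mulf_eq0 subr_eq0 (negbTE sz) /= => /eqP.
  by rewrite /sh upd_neq //; lia.
have [_ _ /(_ j) pa] := bi_a hi Xx Tt (UK _ Uz).
have H : \forall s \near z j, 0 + (M z * W z) * a x t (upd z j s)
    + (- (2 * y x t z)) * S (upd z j s) + 0 * a x t (upd z j s) = 0.
  near=> s.
  have Us : U (upd z j s) by near: s; apply: oU.
  rewrite -(dep_upd dMW (leqnn j) Uz Us) -(y_const Xx Tt (UK _ Us) (UK _ Uz)) //.
  have [_] := codazzi Xx Tt (UK _ Us) => e.
  by rewrite [X in 0 + X]mulrC e; ring.
have := par_lin3 pa pS pa H; rewrite a_j => e.
apply: (mulfI (y_neq0 Xx Tt (UK _ Uz))); rewrite mulr0; lra.
Unshelve. all: by end_near. Qed.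

Let pdiff_W i z : K z -> pdiff i W z.
Proof.
move=> /hKZ Zz; have df := sp_f hp (i := i) Zz.
exact: (pdiffB (pdiffM (pdiffD (pdiff_cst i (eta ^+ 2) z) (pdiffM df df)) (sp_h hp Zz))
  (pdiffM (pdiff_cst i eta z) (pdiffM (sp_df hp Zz) (pdiff_coord i 1 z)))).
Qed.

Let pdiff_S i z : K z -> pdiff i S z.
Proof.
move=> /hKZ Zz; have df := sp_f hp (i := i) Zz.
have df' := sp_df hp (i := i) Zz; have dr := sp_r hp (i := i) Zz.
exact: (pdiffB (pdiffB (pdiffM (pdiff_cst i (eta ^+ 2) z) (pdiffM df' (sp_F hp Zz)))
   (pdiffM (pdiffM (pdiff_cst i eta z) dr) (pdiffM df' (pdiff_coord i 1 z))))
  (pdiffM (pdiffD (pdiff_cst i (eta ^+ 2) z) (pdiffM df df))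
    (pdiffB (pdiffM (pdiff_cst i eta z) (sp_q hp Zz)) (pdiffM (sp_h hp Zz) dr)))).
Qed.

Let copen_W : copen [set z | K z /\ W z != 0].
Proof.
move=> z [Kz Wz] i.
have nW : \forall s \near z i, W (upd z i s) != 0.
  by apply: (near_neq0 (@pdiff_W i z Kz)); rewrite !upd_id.
by apply: filterS2 (oK Kz i) nW => s.
Qed.

Let sqr_neq0 (u : R) : eta ^+ 2 + u * u != 0.
Proof.
by rewrite -expr2 paddr_eq0 ?sqr_ge0 // negb_and expf_eq0 /= eta0.
Qed.

(** If f' <> 0 somewhere, S involves z_k through the term eta^2 f' F. If f' = 0 on the whole box,
    then h' <> 0, and S involves z_(k-1) through q, whose top derivative is h' F_(z_k). Both
    contradict [no_asymptotic], once a point with W <> 0 is found. *)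
Lemma no_asymptotic_x x t zK : X x -> T t -> K zK -> False.
Proof.
move=> Xx Tt Kz0.
have UK : [set z | K z /\ W z != 0] `<=` K by move=> ? [].
have W0 z' : [set z | K z /\ W z != 0] z' -> W z' != 0 by case.
have [[z1 [K1 f1]]|nf'] := pselect (exists z, K z /\ par 0 f z != 0).
  have [z2 [[K2 W2] f2]] : exists z, [set z | K z /\ W z != 0] z /\ par 0 f z != 0.
    have [W1|W1] := eqVneq (W z1) 0; last by exists z1.
    (* W is affine in z_1 with slope - eta f' <> 0, so moving z_1 leaves its zero set. *)
    have [s sz K2] := near_exists_neq (oK K1 1%N).
    exists (upd z1 1 s); rewrite (dep_upd depf' _ K1 K2) //; split => //; split => //=.
    rewrite (dep_upd depf _ K1 K2) // (dep_upd deph _ K1 K2) // (dep_upd depf' _ K1 K2) //.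
    rewrite upd_eq.
    have -> : (eta ^+ 2 + f z1 * f z1) * h z1 - eta * (par 0 f z1 * s) =
      W z1 - eta * (par 0 f z1 * (s - z1 1%N)) by ring.
    by rewrite W1 sub0r oppr_eq0 !mulf_neq0 // subr_eq0.
  have Z2 := hKZ K2.
  have := @no_asymptotic n.+2 _ x t z2 copen_W UK.
  rewrite ltnW //= (bi_m hi) => /(_ isT) H.
  have SF : par n.+2 S z2 = 0.
    apply: H => //.
    - move=> z z' [Kz _] [Kz' _] zz; have zz1 := agree_le (ltn0Sn n.+1) zz.
      rewrite (depf Kz Kz' zz1) (deph Kz Kz' zz1) (depf' Kz Kz' zz1) (depp Kz Kz' zz).
      by rewrite (depr Kz Kz' (agree_le (leqnSn _) zz)) zz.
    - move=> z z' [Kz _] [Kz' _] zz; have zz' := agree_le (leqnSn n.+2) zz.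
      have zz1 := agree_le (ltn0Sn n.+1) zz'.
      rewrite (depf Kz Kz' zz1) (deph Kz Kz' zz1) (depf' Kz Kz' zz1) (depq Kz Kz' zz').
      by rewrite (depr Kz Kz' (agree_le (leqnSn _) zz')) zz' // (depF Kz Kz' zz).
    - move=> z z' [Kz _] [Kz' _] zz; have zz1 := agree_le (ltn0Sn n.+2) zz.
      by rewrite (depf' Kz Kz' zz1) (depF Kz Kz' zz).
    - exact: pdiff_S.
  have Hs : \forall s \near z2 n.+2,
      (eta * r z2 * (par 0 f z2 * z2 1%N)
        + (eta ^+ 2 + f z2 * f z2) * (eta * q z2 - h z2 * r z2))
      + 1 * S (upd z2 n.+2 s) + (- (eta ^+ 2 * par 0 f z2)) * F (upd z2 n.+2 s)
      + 0 * S (upd z2 n.+2 s) = 0.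
    near=> s; have Ks : K (upd z2 n.+2 s) by near: s; apply: oK.
    rewrite !(dep_upd depf _ K2 Ks) // (dep_upd deph _ K2 Ks) // (dep_upd depq _ K2 Ks) //.
    rewrite (dep_upd depr _ K2 Ks) // (dep_upd depf' _ K2 Ks) // upd_neq //.
    by ring.
  have pS := @pdiff_S n.+2 z2 K2.
  have := par_lin3 pS (sp_F hp (i := n.+2) Z2) pS Hs.
  rewrite SF !mulr0 add0r addr0 => /eqP; rewrite mulf_eq0 oppr_eq0.
  by rewrite !mulf_eq0 (negbTE eta0) (negbTE f2) (negbTE (sp_order hp Z2)).
have f'0 z' : K z' -> par 0 f z' = 0.
  by move=> K'; apply: contrapT => /eqP f'; apply: nf'; exists z'.
have h'0 z' : K z' -> par 0 h z' != 0.
  move=> K'; have := sp_nonconst hp (hKZ K').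
  by rewrite f'0 // expr0n add0r expf_eq0.
have [z1 [K1 h1]] : exists z, K z /\ h z != 0.
  apply: contrapT => nh; have := h'0 zK Kz0.
  have -> : par 0 h zK = par 0 (cst 0) zK; last by rewrite par_cst eqxx.
  apply: par_near => //; apply: filterS (oK Kz0 0%N) => s Ks.
  by apply: contrapT => /eqP hs; apply: nh; exists (upd zK 0 s).
have Z1 := hKZ K1.
have W1 : W z1 != 0 by rewrite f'0 // mul0r mulr0 subr0 mulf_neq0.
(* Here p loses z_(k-1), because its top derivative is f' F_(z_k) = 0; hence M W is free of z_j for
   j = k-1, as [no_asymptotic] demands. *)
have depp' : dep n.+1 K p.
  apply: zbox_dep_pred => // z' K'; split; first exact: (sp_p hp (hKZ K')).
  by rewrite (sp_par_p hp (hKZ K')) f'0 // mul0r.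
have := @no_asymptotic n.+1 _ x t z1 copen_W UK.
rewrite ltnSn (leq_trans (leqnSn _) (bi_m hi)) /= => /(_ isT) H.
have SF : par n.+1 S z1 = 0.
  apply: H => //.
  - move=> z' z'' [K' _] [K'' _] zz.
    have zz1 := agree_le (ltn0Sn n) zz.
    rewrite !f'0 // !mul0r (depf K' K'' zz1) (deph K' K'' zz1).
    by rewrite (depr K' K'' zz) (depp' z' z'' K' K'' zz).
  - move=> z' z'' [K' _] [K'' _] zz; have zz' := agree_le (leqnSn n.+1) zz.
    have zz1 := agree_le (ltn0Sn n) zz'.
    rewrite !f'0 // !mul0r (depf K' K'' zz1) (deph K' K'' zz1).
    by rewrite (depr K' K'' zz') (depq K' K'' zz).
  - by move=> z' z'' [K' _] [K'' _] zz; rewrite !f'0 // !mul0r.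
  - exact: pdiff_S.
have Hs : \forall s \near z1 n.+1,
    (- ((eta ^+ 2 + f z1 * f z1) * (h z1 * r z1)))
    + 1 * S (upd z1 n.+1 s)
    + (eta ^+ 2 + f z1 * f z1) * eta * q (upd z1 n.+1 s)
    + 0 * S (upd z1 n.+1 s) = 0.
  near=> s; have Ks : K (upd z1 n.+1 s) by near: s; apply: oK.
  rewrite !f'0 // !(dep_upd depf _ K1 Ks) // (dep_upd deph _ K1 Ks) //.
  by rewrite (dep_upd depr _ K1 Ks) //; ring.
have pS := @pdiff_S n.+1 z1 K1.
have := par_lin3 pS (sp_q hp (i := n.+1) Z1) pS Hs.
rewrite SF !mulr0 add0r addr0 (sp_par_q hp Z1) => /eqP.
by rewrite !mulf_eq0 (negbTE (sqr_neq0 _)) (negbTE eta0) (negbTE (h'0 _ K1))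
  (negbTE (sp_order hp Z1)).
Unshelve. all: by end_near. Qed.

End AsymptoticDirection.

(** * Universal coefficients *)

(* The Codazzi and Gauss equations for coefficients with values a, b, c and first
   derivatives ax, at_, ... with respect to x and t, and none with respect to the
   jet variables, at a given (x, t) and all z in K. *)
Record universal_eqs (R : realType) (eta : R) (K : set (nat -> R))
    (f p r h q : (nat -> R) -> R) (a b c ax at_ bx bt cx ct : R) : Prop := UniversalEqs {
  ue_gauss : a * c - b ^+ 2 = -1;
  ue_eq1 : forall z, K z ->
    f z * at_ + eta * bt - p z * ax - r z * bx - 2 * b * (f z * q z - h z * p z)
      + (a - c) * (eta * q z - h z * r z) = 0;
  ue_eq2 : forall z, K z ->
    f z * bt + eta * ct - p z * bx - r z * cx + (a - c) * (f z * q z - h z * p z)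
      + 2 * b * (eta * q z - h z * r z) = 0
}.

(** This is the discriminant of the characteristic polynomial of the second fundamental form: at
    curvature -1 there are no umbilic points. Up to sign it is also the determinant of the linear
    systems in [ue_affine] and [ue_order_ge3]. *)
Lemma gauss_discriminant (R : realType) (a b c : R) : a * c - b ^+ 2 = -1 ->
  (a - c) ^+ 2 + 4 * b ^+ 2 != 0.
Proof.
move=> G; have -> : (a - c) ^+ 2 + 4 * b ^+ 2 = (a + c) ^+ 2 + 4.
  by rewrite (_ : b ^+ 2 = a * c + 1); [ring|lra].
by rewrite gt_eqF // ltr_wpDl ?sqr_ge0.
Qed.

Lemma sqrD_eq0 (R : realType) (u v : R) : u ^+ 2 + v ^+ 2 = 0 -> u = 0 /\ v = 0.
Proof.
move/eqP; rewrite paddr_eq0 ?sqr_ge0 // !sqrf_eq0 => /andP[/eqP -> /eqP ->].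
by [].
Qed.

(* Along x, kappa = bx/ax is constant, hence mu = - lambda eta kappa and
   b = kappa a, against the Gauss equation. *)
Lemma no_universal_order2 (R : realType) (eta lam mu : R) (X : set R)
    (A B C : R -> R) (x1 : R) : eta != 0 -> mu != 0 -> open X -> X x1 ->
  (forall x, X x -> [/\ derivable A x 1, derivable B x 1 & derivable C x 1]) ->
  (forall x, X x -> A x * C x - B x ^+ 2 = -1) ->
  (forall x, X x -> derive1 A x = lam * eta * (A x - C x) - 2 * B x * mu) ->
  (forall x, X x -> derive1 B x = mu * (A x - C x) + 2 * lam * eta * B x) ->
  derive1 A x1 * derive1 C x1 = derive1 B x1 ^+ 2 ->
  (forall x, X x -> derive1 A x * derive1 B x1 = derive1 A x1 * derive1 B x) ->
  False.
Proof.
move=> eta0 mu0 oX X1 dABC G eA eB eC eAB.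
have [dA dB dC] := dABC _ X1; have G1 := G _ X1.
have A0 : derive1 A x1 != 0.
  apply/eqP => A0; move: eC; rewrite A0 mul0r => /esym/eqP.
  rewrite sqrf_eq0 => /eqP B0.
  have : ((A x1 - C x1) ^+ 2 + 4 * B x1 ^+ 2) * ((lam * eta) ^+ 2 + mu ^+ 2) = 0.
    have <- : derive1 A x1 ^+ 2 + derive1 B x1 ^+ 2 = 0 by rewrite A0 B0 expr0n addr0.
    by rewrite eA // eB //; ring.
  move/eqP; rewrite mulf_eq0 (negbTE (gauss_discriminant G1)) /= => /eqP/sqrD_eq0[_].
  by move/eqP; rewrite (negbTE mu0).
pose k := derive1 B x1 / derive1 A x1.
have Bk : derive1 B x1 = k * derive1 A x1 by rewrite /k divfK.
have Ck : derive1 C x1 = k ^+ 2 * derive1 A x1.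
  by apply: (mulfI A0); rewrite eC Bk; ring.
have Phi x : X x -> (mu - k * lam * eta) * (A x - C x)
    + (2 * lam * eta + 2 * k * mu) * B x = 0.
  move=> Xx; have : derive1 B x - k * derive1 A x = 0.
    apply: (mulfI A0); rewrite mulrBr -eAB // Bk; ring.
  by rewrite eA // eB // => e; rewrite -e; ring.
have dPhi : (mu - k * lam * eta) * (derive1 A x1 - derive1 C x1)
    + (2 * lam * eta + 2 * k * mu) * derive1 B x1 = 0.
  have : derive1 (fun x => (mu - k * lam * eta) * (A x - C x)
    + (2 * lam * eta + 2 * k * mu) * B x) x1 = 0.
    rewrite -(derive1_cst (0 : R) x1); apply: derive1_near.
    by apply: filterS (open_near oX X1) => x; apply: Phi.
  rewrite (derive1_is_derive (is_deriveD
    (is_deriveM (is_derive_cst (mu - k * lam * eta : R) x1 1)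
      (is_deriveB (is_derive_derive1 dA) (is_derive_derive1 dC)))
    (is_deriveM (is_derive_cst (2 * lam * eta + 2 * k * mu : R) x1 1)
      (is_derive_derive1 dB)))).
  by rewrite /GRing.scale /= !mulr0 !addr0.
have k0 : 1 + k ^+ 2 != 0 by rewrite gt_eqF // ltr_pwDl ?sqr_ge0.
have muE : mu = - (lam * eta * k).
  (* As (A', B', C') is proportional to (1, k, k^2), the derivative of [Phi] factors as A' (1 + k^2)
     (mu + lam eta k). *)
  apply/eqP; rewrite -addr_eq0; apply/eqP.
  apply: (mulfI k0); apply: (mulfI A0); rewrite !mulr0 -dPhi Ck Bk; ring.
have lam0 : lam != 0.
  by apply/eqP => l0; move: mu0; rewrite muE l0 !mul0r oppr0 eqxx.
have dG := derive1_gauss dA dB dC.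
have {}dG : C x1 + k ^+ 2 * A x1 = 2 * B x1 * k.
  have {}dG : derive1 A x1 * C x1 + A x1 * derive1 C x1 = 2 * B x1 * derive1 B x1.
    by apply: dG; apply: filterS (open_near oX X1) => x; apply: G.
  by rewrite Ck Bk in dG; apply: (mulfI A0); lra.
have kk : k * (A x1 - C x1) = B x1 * (1 - k ^+ 2).
  have le0 : -2 * (lam * eta) != 0 by rewrite !mulf_neq0 // oppr_eq0 pnatr_eq0.
  apply: (mulfI le0); apply/eqP; rewrite -subr_eq0; apply/eqP.
  by rewrite -(Phi _ X1) muE; ring.
have BA : B x1 = k * A x1.
  by apply: (mulfI k0); rewrite (_ : C x1 = 2 * B x1 * k - k ^+ 2 * A x1) in kk; lra.
have : A x1 * C x1 - B x1 ^+ 2 = 0.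
  have -> : C x1 = 2 * B x1 * k - k ^+ 2 * A x1 by lra.
  by rewrite BA; ring.
by rewrite G1 => /eqP; rewrite oppr_eq0 oner_eq0.
Qed.

Section Universal.
Context {R : realType} (n m : nat) (eta : R).
Context (z0 : nat -> R) (rho : R) (Z : set (nat -> R)).
Context (F f p r h q : (nat -> R) -> R).
Local Notation K := (zbox m z0 rho).
Local Notation ueq := (universal_eqs eta K f p r h q).
Hypothesis eta0 : eta != 0.
Hypothesis hp : seq_pss n eta Z F f p r h q.
Hypothesis hKZ : K `<=` Z.

Let oK : copen K := @zbox_copen R m z0 rho.
Let depf := dep_sub hKZ (sp_depf hp).
Let deph := dep_sub hKZ (sp_deph hp).
Let depp := dep_sub hKZ (sp_depp hp).
Let depq := dep_sub hKZ (sp_depq hp).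
Let depr := dep_sub hKZ (sp_depr hp).

(** The z_(k-1)-derivative of the Codazzi equations: only p and q involve this variable, and the
    common factor F_(z_k) of their derivatives is divided out. *)
Lemma ue_top a b c ax at_ bx bt cx ct z : ueq a b c ax at_ bx bt cx ct -> K z ->
  par 0 f z * ax = (a - c) * eta * par 0 h z
    - 2 * b * (f z * par 0 h z - h z * par 0 f z) /\
  par 0 f z * bx = (a - c) * (f z * par 0 h z - h z * par 0 f z)
    + 2 * b * eta * par 0 h z.
Proof.
move=> [_ e1 e2] Kz; have Zz := hKZ Kz.
have dp := sp_p hp (i := n.+1) Zz; have dq := sp_q hp (i := n.+1) Zz.
have F0 := sp_order hp Zz.
have H1 : \forall s \near z n.+1,
    (f z * at_ + eta * bt - r z * bx - (a - c) * (h z * r z))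
    + (- ax + 2 * b * h z) * p (upd z n.+1 s)
    + ((a - c) * eta - 2 * b * f z) * q (upd z n.+1 s) + 0 * p (upd z n.+1 s) = 0.
  near=> s; have Ks : K (upd z n.+1 s) by near: s; apply: oK.
  have := e1 _ Ks; rewrite !(dep_upd depf _ Kz Ks) // !(dep_upd deph _ Kz Ks) //.
  by rewrite !(dep_upd depr _ Kz Ks) // => e; apply: etrans e; ring.
have H2 : \forall s \near z n.+1,
    (f z * bt + eta * ct - r z * cx - 2 * b * (h z * r z))
    + (- bx - (a - c) * h z) * p (upd z n.+1 s)
    + ((a - c) * f z + 2 * b * eta) * q (upd z n.+1 s) + 0 * p (upd z n.+1 s) = 0.
  near=> s; have Ks : K (upd z n.+1 s) by near: s; apply: oK.
  have := e2 _ Ks; rewrite !(dep_upd depf _ Kz Ks) // !(dep_upd deph _ Kz Ks) //.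
  by rewrite !(dep_upd depr _ Kz Ks) // => e; apply: etrans e; ring.
have := par_lin3 dp dq dp H1; have := par_lin3 dp dq dp H2.
rewrite (sp_par_p hp Zz) (sp_par_q hp Zz) => h2 h1.
split; apply: (mulfI F0); apply/eqP; rewrite -subr_eq0; apply/eqP; apply: oppr_inj.
  by rewrite oppr0 -h1; ring.
by rewrite oppr0 -h2; ring.
Unshelve. all: by end_near. Qed.

(** If f' = 0, then h' <> 0, and [ue_top] becomes a homogeneous linear system in a - c and 2b with
    determinant eta^2 + f^2. Its only solution is an umbilic point. *)
Lemma ue_df_neq0 a b c ax at_ bx bt cx ct z : ueq a b c ax at_ bx bt cx ct ->
  K z -> par 0 f z != 0.
Proof.
move=> ue Kz; apply/eqP => f0; have [e1 e2] := ue_top ue Kz.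
have := sp_nonconst hp (hKZ Kz); rewrite f0 expr0n add0r sqrf_eq0 => h0.
rewrite f0 !mul0r mulr0 subr0 in e1 e2.
have : ((a - c) ^+ 2 + 4 * b ^+ 2) * (eta ^+ 2 + f z ^+ 2) = 0.
  have u1 : (a - c) * eta - 2 * b * f z = 0.
    by apply: (mulfI h0); rewrite mulr0 e1; ring.
  have u2 : (a - c) * f z + 2 * b * eta = 0.
    by apply: (mulfI h0); rewrite mulr0 e2; ring.
  have e : ((a - c) * eta - 2 * b * f z) ^+ 2 + ((a - c) * f z + 2 * b * eta) ^+ 2 = 0.
    by rewrite u1 u2 expr0n addr0.
  by apply: etrans e; ring.
move/eqP; rewrite mulf_eq0 (negbTE (gauss_discriminant (ue_gauss ue))) /=.
by move=> /eqP/sqrD_eq0[/eqP]; rewrite (negbTE eta0).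
Qed.

(** [ue_top] is a linear system for h' and L = f h' - h f', with determinant (a-c)^2 + 4 b^2 up to
    the factor eta. It is solved by h' = lam f' and L = mu f', where lam and mu do not involve z.
    The second formula then gives h = lam f - mu without integration. *)
Lemma ue_affine a b c ax at_ bx bt cx ct : ueq a b c ax at_ bx bt cx ct ->
  exists lam mu, forall z, K z -> par 0 h z = lam * par 0 f z /\ h z = lam * f z - mu.
Proof.
move=> ue; have := gauss_discriminant (ue_gauss ue).
move: {2}(_ + _) (erefl ((a - c) ^+ 2 + 4 * b ^+ 2)) => D DE; rewrite DE => D0.
exists ((ax * (a - c) + 2 * b * bx) / (eta * D)), (((a - c) * bx - 2 * b * ax) / D).
move=> z Kz; have [e1 e2] := ue_top ue Kz; have f0 := ue_df_neq0 ue Kz.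
have hl : par 0 h z = (ax * (a - c) + 2 * b * bx) / (eta * D) * par 0 f z.
  have -> : (ax * (a - c) + 2 * b * bx) / (eta * D) * par 0 f z =
    ((par 0 f z * ax) * (a - c) + 2 * b * (par 0 f z * bx)) / (eta * D).
    by field; rewrite eta0 D0.
  by rewrite e1 e2 -DE; field; rewrite eta0 DE D0.
split => //; apply: (mulfI f0).
have -> : par 0 f z * ((ax * (a - c) + 2 * b * bx) / (eta * D) * f z -
   ((a - c) * bx - 2 * b * ax) / D) =
   f z * ((ax * (a - c) + 2 * b * bx) / (eta * D) * par 0 f z) -
   ((a - c) * (par 0 f z * bx) - 2 * b * (par 0 f z * ax)) / D.
  by field; rewrite eta0 D0.
by rewrite -hl e1 e2 -DE; field; rewrite DE D0.
Qed.

Section Affine.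
Context (lam mu : R).
Hypothesis hf0 : forall z, K z -> par 0 f z != 0.
Hypothesis hlam : forall z, K z -> par 0 h z = lam * par 0 f z.
Hypothesis hmu : forall z, K z -> h z = lam * f z - mu.
Context (zK : nat -> R).
Hypothesis hzK : K zK.

Local Notation g := (fun z => q z - lam * p z).
Local Notation N := (fun z => par 0 f z * par n.+2 F z).

Lemma ue_dx a b c ax at_ bx bt cx ct : ueq a b c ax at_ bx bt cx ct ->
  ax = lam * eta * (a - c) - 2 * b * mu /\ bx = mu * (a - c) + 2 * lam * eta * b.
Proof.
move=> ue; have [e1 e2] := ue_top ue hzK; rewrite hlam // hmu // in e1 e2.
by split; apply: (mulfI (hf0 hzK)); rewrite ?e1 ?e2; ring.
Qed.

(** After substitution of [ax], [bx] and h, the functions p and q enter through g = q - lam p alone,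
    which no longer involves z_(k-1) ([skew_dep]). *)
Lemma ue_reduced a b c ax at_ bx bt cx ct z : ueq a b c ax at_ bx bt cx ct -> K z ->
  f z * at_ + eta * bt - 2 * lam * eta * b * r z - 2 * b * f z * g z
    + (a - c) * (eta * g z - lam * f z * r z) = 0 /\
  f z * bt + eta * ct - r z * cx + (a - c) * f z * g z
    + 2 * b * (eta * g z - lam * f z * r z + mu * r z) = 0.
Proof.
move=> ue Kz; have [ea eb] := ue_dx ue.
have := ue_eq1 ue Kz; have := ue_eq2 ue Kz; rewrite hmu // ea eb => e2 e1.
by split; [apply: etrans e1; ring|apply: etrans e2; ring].
Qed.

Let N0 z : K z -> N z != 0.
Proof. by move=> Kz; rewrite mulf_neq0 ?hf0 // (sp_order hp (hKZ Kz)). Qed.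

Lemma pdiff_skew i z : K z -> pdiff i g z.
Proof.
move=> /hKZ Zz.
exact: (pdiffB (sp_q hp Zz) (pdiffM (pdiff_cst i lam z) (sp_p hp Zz))).
Qed.

Let par_g i z : K z -> par i g z = par i q z - lam * par i p z.
Proof.
move=> /hKZ Zz; have dp := sp_p hp (i := i) Zz; have dq := sp_q hp (i := i) Zz.
have -> : g = fun z => q z + (- lam) * p z by apply/funext => u; rewrite mulNr.
rewrite (parD dq (pdiffM (pdiff_cst i (- lam) z) dp)) (parZ _ dp); ring.
Qed.

Lemma skew_dep : dep n.+1 K g.
Proof.
apply: zbox_dep_pred => [z z' Kz Kz' zz|z Kz].
  by rewrite (depq Kz Kz' zz) (depp Kz Kz' zz).
split; first exact: pdiff_skew.
by rewrite par_g // (sp_par_q hp (hKZ Kz)) (sp_par_p hp (hKZ Kz)) hlam //; ring.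
Qed.

(** F cancels between the third structure equation and lam times the first, because h' = lam f'. *)
Lemma skew_vfield z : K z -> vfield n.+1 sh g z =
  lam * eta * g z - (1 - lam ^+ 2) * (eta * p z - f z * r z) + lam * mu * r z.
Proof.
move=> Kz; rewrite -(vfield_dep_trunc _ oK skew_dep Kz (leqnSn n.+1)).
have -> : vfield n.+2 sh g z = vfield n.+2 sh q z - lam * vfield n.+2 sh p z.
  rewrite /vfield big_distrr -sumrB /=; apply: eq_bigr => i _.
  by rewrite par_g //; ring.
have Zz := hKZ Kz; have := sp_eq1 hp Zz; have := sp_eq3 hp Zz.
rewrite hlam // hmu // => e3 e1.
have e : lam * (par 0 f z * F z) - lam * par 0 f z * F z = 0 by ring.
rewrite e1 e3 in e; apply/eqP; rewrite -subr_eq0; apply/eqP; apply: oppr_inj.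
by rewrite oppr0; apply: etrans e; ring.
Qed.

Let par_r_top z : K z -> par n r z = mu * N z.
Proof. by move=> Kz; rewrite (sp_par_r hp (hKZ Kz)) hlam // hmu //; ring. Qed.

(** The coefficient of z_(k-1) in [skew_vfield], where the right-hand side contains it only through
    p. *)
Let par_g_top z : K z -> par n g z = - ((1 - lam ^+ 2) * eta * N z).
Proof.
move=> Kz.
have H : \forall s \near z n.+1,
    (vfield n.+1 sh g z - z n.+1 * par n g z - lam * eta * g z
      - (1 - lam ^+ 2) * (f z * r z) - lam * mu * r z)
    + par n g z * upd z n.+1 s n.+1
    + ((1 - lam ^+ 2) * eta) * p (upd z n.+1 s) + 0 * p (upd z n.+1 s) = 0.
  near=> s; have Ks : K (upd z n.+1 s) by near: s; apply: oK.
  have := skew_vfield Ks; rewrite (vfield_sh_upd oK skew_dep Kz Ks) //.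
  rewrite (dep_upd depf _ Kz Ks) // (dep_upd depr _ Kz Ks) //.
  rewrite [X in lam * eta * X](dep_upd skew_dep (leqnn _) Kz Ks) upd_eq => e.
  lra.
have dp := sp_p hp (i := n.+1) (hKZ Kz).
have := par_lin3 (pdiff_coord n.+1 n.+1 z) dp dp H.
rewrite par_coord (sp_par_p hp (hKZ Kz)) => e; lra.
Unshelve. all: by end_near. Qed.

Lemma zbox_lin0 u (i : nat) (u0 u1 : R) : (forall z, K z -> pdiff i u z) ->
  (forall z, K z -> par i u z != 0) ->
  (forall z, K z -> u0 + u1 * u z = 0) -> u0 = 0 /\ u1 = 0.
Proof.
move=> du u'0 e; have u10 : u1 = 0.
  have d := du _ hzK.
  have H : \forall s \near zK i, u0 + u1 * u (upd zK i s) + 0 * u (upd zK i s)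
      + 0 * u (upd zK i s) = 0.
    by apply: filterS (oK hzK i) => s /e; rewrite !mul0r !addr0.
  have := par_lin3 d d d H; rewrite !mul0r !addr0 => /eqP.
  by rewrite mulf_eq0 (negbTE (u'0 _ hzK)) orbF => /eqP.
by split => //; have := e _ hzK; rewrite u10 mul0r addr0.
Qed.

Let quad0 u (i : nat) (u0 u1 u2 : R) : (forall z, K z -> pdiff i u z) ->
  (forall z, K z -> par i u z != 0) ->
  (forall z, K z -> u0 + u1 * u z + u2 * (u z * u z) = 0) -> u2 = 0.
Proof.
move=> du u'0 e.
have [_ /eqP] : u1 = 0 /\ 2 * u2 = 0.
  apply: (zbox_lin0 du u'0) => z Kz; have d := du _ Kz.
  have H : \forall s \near z i, u0 + u1 * u (upd z i s)
      + u2 * (fun z => u z * u z) (upd z i s) + 0 * u (upd z i s) = 0.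
    by apply: filterS (oK Kz i) => s /e; rewrite !mul0r !addr0.
  have := par_lin3 d (pdiffM d d) d H; rewrite (parM d d) => e'.
  by apply: (mulfI (u'0 _ Kz)); rewrite mulr0 -e'; ring.
by rewrite mulf_eq0 pnatr_eq0 /= => /eqP.
Qed.

Let df i z : K z -> pdiff i f z. Proof. by move=> /hKZ; apply: (sp_f hp). Qed.
Let dr i z : K z -> pdiff i r z. Proof. by move=> /hKZ; apply: (sp_r hp). Qed.

Let conclude (u : R) : u != 0 -> u * ((1 - lam ^+ 2) * eta) ^+ 2 + u * (lam * mu) ^+ 2 = 0 ->
  lam ^+ 2 = 1 /\ mu = 0.
Proof.
move=> u0; rewrite -mulrDr => /eqP; rewrite mulf_eq0 (negbTE u0) /=.
move=> /eqP/sqrD_eq0[/eqP e1 /eqP e2].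
have l1 : lam ^+ 2 = 1.
  by move: e1; rewrite mulf_eq0 (negbTE eta0) orbF subr_eq0 => /eqP.
split=> //; apply/eqP; move: e2; rewrite mulf_eq0 => /orP[|//] /eqP l0.
by move: l1; rewrite l0 expr0n => /eqP; rewrite eq_sym oner_eq0.
Qed.

(** For k >= 3 the variable z_(k-2) is not z_0, so f is constant along it and only r and g
    contribute to the derivative of the first reduced equation. The result is affine in f, so both
    its coefficients vanish: a linear system for (1 - lam^2) eta and lam mu whose determinant is, up
    to sign, (a-c)^2 + 4 b^2. *)
Lemma ue_order_ge3 a b c ax at_ bx bt cx ct : (0 < n)%N ->
  ueq a b c ax at_ bx bt cx ct -> lam ^+ 2 = 1 /\ mu = 0.
Proof.
move=> n0 ue.
have [e1 e2] : - (2 * lam * eta * b * mu) - (a - c) * eta * ((1 - lam ^+ 2) * eta) = 0 /\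
    2 * b * ((1 - lam ^+ 2) * eta) - (a - c) * (lam * mu) = 0.
  apply: (zbox_lin0 (df (i := 0%N)) hf0) => z Kz.
  have H : \forall s \near z n, (f z * at_ + eta * bt)
      + (- (2 * lam * eta * b) - (a - c) * (lam * f z)) * r (upd z n s)
      + ((a - c) * eta - 2 * b * f z) * g (upd z n s) + 0 * r (upd z n s) = 0.
    near=> s; have Ks : K (upd z n s) by near: s; apply: oK.
    have [e _] := ue_reduced ue Ks; rewrite !(dep_upd depf n0 Kz Ks) in e.
    by apply: etrans e; ring.
  have := par_lin3 (dr (i := n) Kz) (pdiff_skew (i := n) Kz) (dr (i := n) Kz) H.
  rewrite (par_r_top Kz) (par_g_top Kz) => e.
  by apply: (mulfI (N0 Kz)); rewrite mulr0 -e; ring.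
apply: (conclude (gauss_discriminant (ue_gauss ue))).
have e3 : 2 * lam * b * mu + (a - c) * ((1 - lam ^+ 2) * eta) = 0.
  by apply: (mulfI eta0); rewrite mulr0 -[RHS]oppr0 -e1; ring.
have e : 0 ^+ 2 + 0 ^+ 2 = 0 :> R by rewrite expr0n addr0.
by rewrite -{1}e2 -{1}e3 in e; apply: etrans e; ring.
Unshelve. all: by end_near. Qed.

(** * Universal coefficients for k = 2, where f, r and g are all functions of z_0 *)

Section OrderTwo.
Hypothesis n0 : n = 0%N.
Hypothesis not_one : ~ (lam ^+ 2 = 1 /\ mu = 0).

Let depr1 : dep 1 K r. Proof. by move: depr; rewrite n0. Qed.
Let depg1 : dep 1 K g. Proof. by move: skew_dep; rewrite n0. Qed.
Let par_r0 z : K z -> par 0 r z = mu * N z.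
Proof. by move=> Kz; rewrite -{1}n0 par_r_top. Qed.
Let par_g0 z : K z -> par 0 g z = - ((1 - lam ^+ 2) * eta * N z).
Proof. by move=> Kz; rewrite -{1}n0 par_g_top. Qed.

Local Notation G := (fun z => eta * g z + mu * r z).
Local Notation w := (fun z => lam * mu + (1 - lam ^+ 2) * f z).

(** r' and g' are both multiples of N, so a suitable combination of the equations for D_x r and D_x
    g contains no z_1. In it p cancels too, and what remains factors. *)
Let wG z : K z -> w z * G z = 0.
Proof.
move=> Kz; have := skew_vfield Kz; have := sp_eq2 hp (hKZ Kz).
rewrite n0 /vfield !big_ord1 /= par_g0 // par_r0 // hmu // => e2 e1.
have e : mu * (sh 0 z * - ((1 - lam ^+ 2) * eta * N z))
  + (1 - lam ^+ 2) * eta * (sh 0 z * (mu * N z)) = 0 by ring.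
by rewrite e1 e2 in e; apply: etrans e; ring.
Qed.

Let pdiff_G i z : K z -> pdiff i G z.
Proof.
move=> Kz; exact: (pdiffD (pdiffM (pdiff_cst i eta z) (pdiff_skew (i := i) Kz))
  (pdiffM (pdiff_cst i mu z) (dr (i := i) Kz))).
Qed.

Let par_G z : K z -> par 0 G z = N z * (mu ^+ 2 - (1 - lam ^+ 2) * eta ^+ 2).
Proof.
move=> Kz; have dg := pdiff_skew (i := 0%N) Kz; have d := dr (i := 0%N) Kz.
rewrite (parD (pdiffM (pdiff_cst 0 eta z) dg) (pdiffM (pdiff_cst 0 mu z) d)).
by rewrite (parZ _ dg) (parZ _ d) par_g0 // par_r0 //; ring.
Qed.

(** The affine function w of f is not identically zero, as lam mu = 1 - lam^2 = 0 is excluded by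
    [not_one]. Where w <> 0, G vanishes, and differentiating w G = 0 there leaves w G' = 0. *)
Let muE : mu ^+ 2 = (1 - lam ^+ 2) * eta ^+ 2.
Proof.
have [z1 [K1 w1]] : exists z, K z /\ w z != 0.
  apply: contrapT => nw; apply: not_one.
  have [e1 e2] : lam * mu = 0 /\ 1 - lam ^+ 2 = 0.
    apply: (zbox_lin0 (df (i := 0%N)) hf0) => z Kz.
    by apply: contrapT => /eqP wz; apply: nw; exists z.
  by apply: (conclude (oner_neq0 R)); rewrite e1 e2 mul0r expr0n mulr0 addr0.
have dw : pdiff 0 w z1.
  exact: (pdiffD (pdiff_cst 0 (lam * mu) z1)
    (pdiffM (pdiff_cst 0 (1 - lam ^+ 2) z1) (df (i := 0%N) K1))).
have G1 : G z1 = 0.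
  by apply: (mulfI w1); rewrite mulr0 wG.
have : par 0 (fun z => w z * G z) z1 = 0.
  rewrite -(par_cst 0 0 z1); apply: par_near => //.
  by apply: filterS (oK K1 0%N) => s /wG.
rewrite (parM dw (pdiff_G (i := 0%N) K1)) G1 mul0r addr0 par_G //.
move/eqP; rewrite !mulf_eq0 (negbTE w1) (negbTE (hf0 K1)).
by rewrite (negbTE (sp_order hp (hKZ K1))) /= subr_eq0 => /eqP.
Qed.

Let mu0 : mu != 0.
Proof.
apply/eqP => mu0; apply: not_one; split=> //.
move/eqP: muE; rewrite mu0 expr0n eq_sym mulf_eq0 expf_eq0 (negbTE eta0) andbF orbF.
by rewrite subr_eq0 eq_sym => /eqP.
Qed.

Let g_r z : K z -> g z = - mu * r z / eta.
Proof.
have dG : dep 0 K G.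
  apply: (@zbox_dep0 _ m z0 rho 1) => [z1 z2 K1 K2 zz|i z1].
    by rewrite (depg1 K1 K2 zz) (depr1 K1 K2 zz).
  rewrite ltnS leqn0 => /eqP -> K1; split; first exact: pdiff_G.
  by rewrite par_G // muE subrr mulr0.
move=> Kz; suff G0 : G z = 0.
  by apply: (mulfI eta0); rewrite [RHS]mulrC divfK // mulNr; apply/eqP; rewrite -addr_eq0 G0.
apply/eqP; apply: contrapT => /negP Gz; apply: not_one.
have [e1 e2] : lam * mu = 0 /\ 1 - lam ^+ 2 = 0.
  apply: (zbox_lin0 (df (i := 0%N)) hf0) => z' Kz'.
  by apply: (mulIf Gz); rewrite mul0r (dG z z' Kz Kz') // wG.
by apply: (conclude (oner_neq0 R)); rewrite e1 e2 mul0r expr0n mulr0 addr0.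
Qed.

(* The equations are bilinear relations between f and r; r being nonconstant, two
   such relations are proportional. *)
Let bilinear (u0 u1 u2 u3 v0 v1 v2 v3 : R) :
  (forall z, K z -> u0 + u1 * f z + u2 * r z + u3 * (f z * r z) = 0) ->
  (forall z, K z -> v0 + v1 * f z + v2 * r z + v3 * (f z * r z) = 0) ->
  u3 * v2 = v3 * u2.
Proof.
move=> eu ev; apply/eqP; rewrite eq_sym -subr_eq0; apply/eqP.
apply: (@quad0 r 0 (u0 * v1 - v0 * u1) (u0 * v3 + u2 * v1 - v0 * u3 - v2 * u1)).
- by move=> z; apply: dr.
- by move=> z Kz; rewrite par_r0 // mulf_neq0 // N0.
move=> z Kz; have e : (v1 + v3 * r z) * 0 - (u1 + u3 * r z) * 0 = 0 by ring.
rewrite -{1}(eu z Kz) -{1}(ev z Kz) in e.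
by apply: etrans e; ring.
Qed.

Let ue_bilinear a b c ax at_ bx bt cx ct : ueq a b c ax at_ bx bt cx ct ->
  (forall z, K z -> eta ^+ 2 * bt + (eta * at_) * f z + (- (eta * bx)) * r z
    + (- ax) * (f z * r z) = 0) /\
  (forall z, K z -> eta ^+ 2 * ct + (eta * bt) * f z + (- (eta * cx)) * r z
    + (- bx) * (f z * r z) = 0).
Proof.
move=> ue; have [ea eb] := ue_dx ue.
split=> z Kz; have [e1 e2] := ue_reduced ue Kz.
  rewrite -(mulr0 eta) -e1 (g_r Kz) ea eb; by field.
by rewrite -(mulr0 eta) -e2 (g_r Kz) eb; field.
Qed.

(** By [bilinear], the coefficients of r and f r in any two of the relations are proportional.
    Applied to both relations at x1, this gives A' C' = B'^2; applied to the first relation at x1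
    and at x, it makes B'/A' constant. *)
Lemma ue_order2 (X : set R) (A B C At Bt Ct : R -> R) (x1 : R) : open X -> X x1 ->
  (forall x, X x -> [/\ derivable A x 1, derivable B x 1 & derivable C x 1]) ->
  (forall x, X x -> ueq (A x) (B x) (C x) (derive1 A x) (At x) (derive1 B x) (Bt x)
    (derive1 C x) (Ct x)) -> False.
Proof.
move=> oX X1 dABC ue.
apply: (@no_universal_order2 _ eta lam mu X A B C x1) => //.
- by move=> x Xx; apply: ue_gauss (ue x Xx).
- by move=> x Xx; have [] := ue_dx (ue x Xx).
- by move=> x Xx; have [] := ue_dx (ue x Xx).
- have [e1 e2] := ue_bilinear (ue x1 X1); have := bilinear e1 e2.
  by move=> e; apply: (mulfI eta0); rewrite expr2; lra.
- move=> x Xx; have [e1 _] := ue_bilinear (ue x1 X1).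
  have [e2 _] := ue_bilinear (ue x Xx); have := bilinear e1 e2.
  by move=> e; apply: (mulfI eta0); lra.
Qed.

End OrderTwo.
End Affine.
End Universal.

(** * From an immersion that is universal on a box to the relation between f_31 and f_11 *)

Section LocalUniversal.
Context {R : realType} (n m : nat) (eta : R) (X T : set R).
Context (z0 : nat -> R) (rho : R) (Z : set (nat -> R)).
Context (F f p r h q : (nat -> R) -> R) (J : nat -> (nat -> R) -> R) (a b c : jetfun R).
Local Notation K := (zbox m z0 rho).
Hypothesis eta0 : eta != 0.
Hypothesis hp : seq_pss n eta Z F f p r h q.
Hypothesis hKZ : K `<=` Z.
Hypothesis hi : box_imm n m eta X T K F f p r h q J a b c.
Hypothesis dep0 : forall x t, X x -> T t ->
  [/\ dep 0 K (a x t), dep 0 K (b x t) & dep 0 K (c x t)].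

Let oK : copen K := @zbox_copen R m z0 rho.

Lemma universal_eqs_of_imm x t zK : X x -> T t -> K zK ->
  universal_eqs eta K f p r h q (a x t zK) (b x t zK) (c x t zK)
    (dx a x t zK) (dt a x t zK) (dx b x t zK) (dt b x t zK) (dx c x t zK) (dt c x t zK).
Proof.
move=> Xx Tt KK.
have oX := bi_X hi; have oT := bi_T hi.
have da x' t' Xx' Tt' := let: And3 u _ _ := dep0 Xx' Tt' in u : dep 0 K (a x' t').
have db x' t' Xx' Tt' := let: And3 _ u _ := dep0 Xx' Tt' in u : dep 0 K (b x' t').
have dc x' t' Xx' Tt' := let: And3 _ _ u := dep0 Xx' Tt' in u : dep 0 K (c x' t').
have eX g z : (forall x' t', X x' -> T t' -> dep 0 K (g x' t')) -> K z ->
    dX m g x t z = dx g x t zK.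
  move=> dg Kz; rewrite /dX /dir (vfield_dep_trunc _ oK (dg _ _ Xx Tt) Kz) //.
  rewrite /vfield big_ord0 mul1r mul0r !addr0.
  by apply: (dx_dep oX Xx Kz KK (n := 0)) => // x' Xx'; apply: dg.
have eT g z : (forall x' t', X x' -> T t' -> dep 0 K (g x' t')) -> K z ->
    dT m J g x t z = dt g x t zK.
  move=> dg Kz; rewrite /dT /dir (vfield_dep_trunc _ oK (dg _ _ Xx Tt) Kz) //.
  rewrite /vfield big_ord0 mul1r mul0r !addr0 add0r.
  by apply: (dt_dep oT Tt Kz KK (n := 0)) => // t' Tt'; apply: dg.
split.
- exact: (bi_gauss hi Xx Tt KK).
- move=> z Kz; have := bi_eq1 hi Xx Tt Kz; rewrite !eX // !eT //.
  by rewrite (da x t Xx Tt z zK) // (db x t Xx Tt z zK) // (dc x t Xx Tt z zK).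
- move=> z Kz; have := bi_eq2 hi Xx Tt Kz; rewrite !eX // !eT //.
  by rewrite (da x t Xx Tt z zK) // (db x t Xx Tt z zK) // (dc x t Xx Tt z zK).
Qed.

Lemma universal_direction x t zK : X x -> T t -> K zK ->
  exists2 lam, lam ^+ 2 = 1 & forall z, K z ->
    [/\ par 0 f z != 0, par 0 h z = lam * par 0 f z & h z = lam * f z].
Proof.
move=> Xx Tt KK; have ue x' Xx' := universal_eqs_of_imm (x := x') Xx' Tt KK.
have hf0 z Kz := ue_df_neq0 eta0 hp hKZ (ue x Xx) (z := z) Kz.
have [lam [mu lm]] := ue_affine eta0 hp hKZ (ue x Xx).
have hlam z Kz := (lm z Kz).1; have hmu z Kz := (lm z Kz).2.
have [l1 m0] : lam ^+ 2 = 1 /\ mu = 0.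
  have [n0|n0] := posnP n; last first.
    exact: (ue_order_ge3 eta0 hp hKZ hf0 hlam hmu KK n0 (ue x Xx)).
  apply: contrapT => hn.
  apply: (ue_order2 eta0 hp hKZ hf0 hlam hmu KK n0 hn (A := fun x => a x t zK)
    (B := fun x => b x t zK) (C := fun x => c x t zK)
    (At := fun x => dt a x t zK) (Bt := fun x => dt b x t zK)
    (Ct := fun x => dt c x t zK) (bi_X hi) Xx) => // x' Xx'.
  have [? _ _] := bi_a hi Xx' Tt KK; have [? _ _] := bi_b hi Xx' Tt KK.
  by have [? _ _] := bi_c hi Xx' Tt KK.
exists lam => // z Kz; split; [exact: hf0|exact: hlam|].
by rewrite hmu // m0 subr0.
Qed.

End LocalUniversal.

(** * Total derivatives as finite sums *)

Section JetFunctions.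
Context {R : realType}.
Implicit Types (g : jetfun R) (z : nat -> R).

Lemma fsum_nat (N : nat) (u : nat -> R) : (forall i, (N <= i)%N -> u i = 0) ->
  \sum_(i \in [set: nat]) u i = \sum_(i < N) u i.
Proof.
move=> u0; rewrite fsbig_ord; apply/esym/fsbig_widen => // i /= [_ /negP].
by rewrite -leqNgt; apply: u0.
Qed.

Lemma copenT : copen [set: nat -> R].
Proof. by move=> z _ i; near=> s. Unshelve. all: by end_near. Qed.

Lemma Dx_vfield N g x t z : dep N setT (g x t) ->
  Dx g x t z = dx g x t z + vfield N sh (g x t) z.
Proof.
move=> dg; rewrite /Dx (@fsum_nat N) // => i Ni.
by rewrite [dz _ _ _ _ _](par_dep0 copenT dg) ?mulr0.
Qed.

Lemma Dt_vfield N (F : jetfun R) g x t z : dep N setT (g x t) ->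
  Dt F g x t z = dt g x t z + vfield N (fun i => iter i (@Dx R) F x t) (g x t) z.
Proof.
move=> dg; rewrite /Dt (@fsum_nat N) // => i Ni.
by rewrite [dz _ _ _ _ _](par_dep0 copenT dg) ?mulr0.
Qed.

Context (k : nat) (F : 'rV[R]_k.+1 -> R).

(** D_x^i F does not involve x and t, so its value at x = t = 0 represents it ([jetF_dep]). *)
Definition jetF (i : nat) : (nat -> R) -> R := iter i (@Dx R) (jet_of_z F) 0 0.

Lemma jetF_dep i : (forall x t, iter i (@Dx R) (jet_of_z F) x t = jetF i) /\
  dep (k.+1 + i) setT (jetF i).
Proof.
elim: i => [|i [IH1 IH2]].
  by rewrite addn0; split => //; apply: trunc_dep.
have e x t z : iter i.+1 (@Dx R) (jet_of_z F) x t z = vfield (k.+1 + i) sh (jetF i) z.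
  rewrite iterS (@Dx_vfield (k.+1 + i)) ?IH1 //.
  have -> : dx (iter i (@Dx R) (jet_of_z F)) x t z = derive1 (cst (jetF i z) : R -> R) x.
    by congr derive1; apply/funext => s; rewrite IH1.
  by rewrite derive1_cst add0r.
split; first by move=> x t; apply/funext => z; rewrite /jetF !e.
move=> z z' _ _ zz; rewrite /jetF !e /vfield; apply: eq_bigr => j _.
have jk : (j.+1 < k.+1 + i.+1)%N by rewrite addnS ltnS.
rewrite /sh zz //; congr (_ * _); apply: (par_dep j copenT IH2) => // l li.
by apply: zz; apply: leq_trans li _; rewrite leq_add2l.
Qed.

(** Each application of D_x gives a function exactly affine in its new top variable, with the
    previous top derivative as slope. No regularity of F is therefore required. *)
Lemma jetF_par i z : par (k + i) (jetF i) z = par k (tfun F) z.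
Proof.
elim: i z => [|i IH] z; first by rewrite addn0.
have [e1 dF] := jetF_dep i.
have e z' : jetF i.+1 z' = vfield (k.+1 + i) sh (jetF i) z'.
  rewrite /jetF iterS (@Dx_vfield (k.+1 + i)) ?e1 //.
  have -> : dx (iter i (@Dx R) (jet_of_z F)) 0 0 z' = derive1 (cst (jetF i z') : R -> R) 0.
    by congr derive1; apply/funext => s; rewrite e1.
  by rewrite derive1_cst add0r.
rewrite addnS -IH; set l := (k + i)%N; set d := par l (jetF i) z.
have pc := pdiff_coord l.+1 l.+1 z.
have -> : par l.+1 (jetF i.+1) z =
    par l.+1 (fun y => (vfield l.+1 sh (jetF i) z - d * z l.+1) + d * y l.+1) z.
  apply: par_near => //; near=> s; rewrite e addSn.
  by rewrite (vfield_sh_upd copenT dF) // upd_eq /d; ring.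
rewrite (parD (pdiff_cst l.+1 (vfield l.+1 sh (jetF i) z - d * z l.+1) z)
  (pdiffM (pdiff_cst l.+1 d z) pc)).
by rewrite par_cst (parZ _ pc) par_coord add0r mulr1.
Unshelve. all: by end_near. Qed.

End JetFunctions.

Lemma connected_locally_constant (T : topologicalType) (U : Type) (A : set T)
    (f : T -> U) p q :
  open A -> connected A -> (forall p, A p -> \forall y \near p, f y = f p) ->
  A p -> A q -> f p = f q.
Proof.
move=> oA cA lc Ap Aq.
have oB (P : U -> Prop) : open [set y | A y /\ P (f y)].
  rewrite openE => y [Ay Py]; rewrite /interior.
  have nA : \forall y' \near y, A y' by move: oA; rewrite openE => /(_ _ Ay).
  by apply: filterS2 nA (lc y Ay) => y' Ay' e; split=> //; rewrite e.
have BA : [set y | A y /\ f y = f p] = A.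
  apply: cA.
  - by exists p.
  - exists [set y | A y /\ f y = f p]; first exact: (oB (fun u => u = f p)).
    by rewrite predeqE => y; split=> [[]|[_ []]].
  - exists (~` [set y | A y /\ f y <> f p]).
      by apply: open_closedC; apply: (oB (fun u => u <> f p)).
    rewrite predeqE => y; split=> [[Ay e]|[Ay ne]]; split=> //; first by case.
    by apply: contrapT => e; apply: ne.
by move: Aq; rewrite -BA => -[_ ->].
Qed.

(** * From jet space to boxes *)

Section JetSpace.
Context {R : realType} (m : nat).
Local Notation E := ((R * R) * 'rV[R]_m.+1)%type.
Implicit Types (g : E -> R) (z : nat -> R).

Lemma nbhs_box (A : set E) x t z : nbhs ((x, t), trunc m z) A ->
  exists2 rho : R, 0 < rho & forall x' t' z', `|x' - x| < rho -> `|t' - t| < rho ->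
    zbox m z rho z' -> A ((x', t'), trunc m z').
Proof.
move=> /nbhs_ballP[rho /= rho0 hA]; exists rho => // x' t' z' hx ht hz.
apply: hA; split => /=; last exact/trunc_ball.
by split; rewrite /ball /= distrC.
Qed.

Lemma dx_derive g x t z :
  dx (jet_of_xtz g) x t z = 'D_(((1, 0), 0) : E) g ((x, t), trunc m z).
Proof.
apply: (@derive1_line _ E g (fun s => ((s, t), trunc m z)) x) => s.
congr ((_, _), _); rewrite /= ?scaler0 ?add0r //.
by rewrite [s *: 1]mulr1.
Qed.

Lemma dt_derive g x t z :
  dt (jet_of_xtz g) x t z = 'D_(((0, 1), 0) : E) g ((x, t), trunc m z).
Proof.
apply: (@derive1_line _ E g (fun s => ((x, s), trunc m z)) t) => s.
congr ((_, _), _); rewrite /= ?scaler0 ?add0r //.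
by rewrite [s *: 1]mulr1.
Qed.

Lemma par_derive g x t z i : (i <= m)%N -> par i (jet_of_xtz g x t) z =
  'D_(((0, 0), delta_mx 0 (inord i)) : E) g ((x, t), trunc m z).
Proof.
move=> im; have := @derive1_line _ E g (fun s => ((x, t), trunc m (upd z i s)))
  (z i) ((0, 0), delta_mx 0 (inord i)).
rewrite upd_id; apply => s; rewrite trunc_line //.
by congr ((_, _), _); rewrite /= ?scaler0 ?add0r.
Qed.

Lemma jet_diff_smooth (U : set E) (X T : set R) (K : set (nat -> R)) g : smooth_on U g ->
  (forall x t z, X x -> T t -> K z -> U ((x, t), trunc m z)) ->
  jet_diff X T K (jet_of_xtz g).
Proof.
move=> sg XTK x t z Xx Tt Kz.
have dg := smooth_differentiable sg (XTK x t z Xx Tt Kz).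
split.
- apply: (@derivable_line _ E g (fun s => ((s, t), trunc m z)) x ((1, 0), 0)) => [s|].
    by congr ((_, _), _); rewrite /= ?scaler0 ?add0r // [s *: 1]mulr1.
  exact: diff_derivable.
- apply: (@derivable_line _ E g (fun s => ((x, s), trunc m z)) t ((0, 1), 0)) => [s|].
    by congr ((_, _), _); rewrite /= ?scaler0 ?add0r // [s *: 1]mulr1.
  exact: diff_derivable.
move=> i; case: (leqP i m) => im; last first.
  rewrite /pdiff (_ : (fun s => _) = cst (g ((x, t), trunc m z))).
    exact: derivable_cst.
  by apply/funext => s; rewrite /jet_of_xtz trunc_out.
have := @derivable_line _ E g (fun s => ((x, t), trunc m (upd z i s)))
  (z i) ((0, 0), delta_mx 0 (inord i)).
rewrite upd_id; apply; last exact: diff_derivable.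
move=> s; rewrite trunc_line //.
by congr ((_, _), _); rewrite /= ?scaler0 ?add0r.
Qed.

Lemma jet_dep (U : set (nat -> R)) g x t : dep m.+1 U (jet_of_xtz g x t).
Proof. exact: (trunc_dep (fun y => g ((x, t), y))). Qed.

Lemma trunc_seq_of_continuous k : (k <= m)%N ->
  continuous (fun y : 'rV[R]_m.+1 => trunc k (seq_of y)).
Proof.
move=> km y A /nbhs_ballP[e /= e0 hA]; apply/nbhs_ballP; exists e => // y' [_ hy].
apply: hA; split => // i j; rewrite !mxE /seq_of.
have jm : (j <= m)%N by rewrite -ltnS (leq_trans (ltn_ord j)).
by rewrite jm; apply: hy.
Qed.

(** The hypothesis on [W'] expresses that the zeros of g are dense in W. *)
Lemma continuous_zero_dense (W : set E) g : open W ->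
  (forall p, W p -> {for p, continuous g}) ->
  (forall W' : set E, open W' -> W' `<=` W -> W' !=set0 -> exists2 p, W' p & g p = 0) ->
  forall p, W p -> g p = 0.
Proof.
move=> oW cg dense p Wp; apply/eqP; apply: contrapT => /negP gp.
have n0 : nbhs p [set y | W y /\ g y != 0].
  have nW : \forall y \near p, W y by move: oW; rewrite openE => /(_ _ Wp).
  by apply: filterS2 nW (cvgr_neq0 _ (cg _ Wp) gp) => y.
have [] := dense [set y | W y /\ g y != 0]^°.
- exact: open_interior.
- by move=> y /interior_subset[].
- by exists p.
by move=> y /interior_subset[_ /eqP].
Qed.

End JetSpace.

Section Immersion.
Context {R : realType} (n m : nat) (eta : R) (V : set 'rV[R]_n.+3)
  (F : 'rV[R]_n.+3 -> R) (w : oneforms R n.+2).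
Context (Omega : set (R * R)) (Vm : set 'rV[R]_m.+1) (a b c : R * R * 'rV[R]_m.+1 -> R).
Local Notation E := ((R * R) * 'rV[R]_m.+1)%type.
Hypothesis eta0 : eta != 0.
Hypothesis hpss : describes_pss eta V F w.
Hypothesis himm : finite_jet_immersion eta V F w Omega Vm a b c.
Implicit Types z : nat -> R.

Let Z := [set z | V (trunc n.+2 z)].
Let W : set E := Omega `*` Vm.
Let hp := describes_pss_seq hpss.

Lemma imm_open : open W.
Proof.
rewrite openE; case=> o y [/= Oo Vy]; exists (Omega, Vm); last by move=> p [].
split.
  by have := imm_Omega_open himm; rewrite openE => /(_ _ Oo).
by have := imm_Vm_open himm; rewrite openE => /(_ _ Vy).
Qed.

Definition xball (x0 rho : R) : set R := [set x | `|x - x0| < rho].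

Lemma xball_open x0 rho : open (xball x0 rho).
Proof. by rewrite openE => x /near_lt_dist. Qed.

Definition inside (W' : set E) x0 t0 z0 rho := 0 < rho /\ forall x t z,
  xball x0 rho x -> xball t0 rho t -> zbox m z0 rho z -> W' ((x, t), trunc m z).

Definition universal_on x0 t0 z0 rho := forall x t, xball x0 rho x -> xball t0 rho t ->
  [/\ dep 0 (zbox m z0 rho) (jet_of_xtz a x t),
      dep 0 (zbox m z0 rho) (jet_of_xtz b x t) &
      dep 0 (zbox m z0 rho) (jet_of_xtz c x t)].

Lemma inside_center W' x0 t0 z0 rho : inside W' x0 t0 z0 rho ->
  [/\ xball x0 rho x0, xball t0 rho t0 & zbox m z0 rho z0].
Proof. by move=> [r0 _]; split; rewrite /xball /zbox /= => *; rewrite subrr normr0. Qed.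

Lemma imm_box x0 t0 z0 rho : inside W x0 t0 z0 rho ->
  zbox m z0 rho `<=` Z /\
  box_imm n m eta (xball x0 rho) (xball t0 rho) (zbox m z0 rho)
    (tfun F) (tfun (f11 w)) (tfun (f12 w)) (tfun (f22 w)) (tfun (f31 w)) (tfun (f32 w))
    (jetF F) (jet_of_xtz a) (jet_of_xtz b) (jet_of_xtz c).
Proof.
move=> hin; have [x0x0 t0t0 _] := inside_center hin; case: hin => r0 hin.
split.
  by move=> z Kz; apply: (imm_Vm_proj himm); have [] := hin _ _ _ x0x0 t0t0 Kz.
have DXE (g : E -> R) x t z : Dx (jet_of_xtz g) x t z = dX m (jet_of_xtz g) x t z.
  by rewrite (@Dx_vfield _ m.+1) ?/dX ?/dir ?mul1r ?mul0r ?addr0 //; apply: jet_dep.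
have DTE (g : E -> R) x t z :
    Dt (jet_of_z F) (jet_of_xtz g) x t z = dT m (jetF F) (jet_of_xtz g) x t z.
  rewrite (@Dt_vfield _ m.+1) ?/dT ?/dir; last exact: jet_dep.
  rewrite mul1r mul0r add0r; congr (_ + vfield _ _ _ _).
  by apply/funext => i; rewrite (jetF_dep F i).1.
have eqs x t z (Xx : xball x0 rho x) (Tt : xball t0 rho t) (Kz : zbox m z0 rho z) :
    codazzi_gauss eta F w (jet_of_xtz a) (jet_of_xtz b) (jet_of_xtz c) x t z.
  by have [Ox Vz] := hin x t z Xx Tt Kz; apply: imm_eqs himm _ _ _ Ox Vz.
split.
- exact: xball_open.
- exact: xball_open.
- exact: imm_order himm.
- by [].
- by move=> i; apply: (jetF_dep F i).2.
- by move=> i z; apply: jetF_par.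
- exact: jet_diff_smooth (imm_smooth_a himm) hin.
- exact: jet_diff_smooth (imm_smooth_b himm) hin.
- exact: jet_diff_smooth (imm_smooth_c himm) hin.
- by move=> x t _ _; apply: jet_dep.
- by move=> x t _ _; apply: jet_dep.
- by move=> x t _ _; apply: jet_dep.
- by move=> x t z Xx Tt Kz; have [] := eqs x t z Xx Tt Kz; rewrite !DXE !DTE.
- by move=> x t z Xx Tt Kz; have [] := eqs x t z Xx Tt Kz; rewrite !DXE !DTE.
- by move=> x t z Xx Tt Kz; have [] := eqs x t z Xx Tt Kz.
Qed.

(** Q is not identically zero on [W'] by [no_asymptotic_x], and a box around a point with Q <> 0
    will do. The arbitrary [W'] makes this a density statement, which the exceptional form
    requires. *)
Lemma imm_locally_universal (W' : set E) : open W' -> W' `<=` W -> W' !=set0 ->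
  exists x0 t0 z0 rho, inside W' x0 t0 z0 rho /\ universal_on x0 t0 z0 rho.
Proof.
move=> oW' W'W [[[x t] y] W'p].
pose f (p : E) := f11 w (trunc n.+2 (seq_of p.2)).
pose Q (p : E) := a p * (f p * f p) + 2 * eta * b p * f p + eta ^+ 2 * c p.
have km : (n.+2 <= m)%N := imm_order himm.
have fE x' t' z : f ((x', t'), trunc m z) = tfun (f11 w) z.
  rewrite /f /tfun; congr (f11 w _); apply/rowP => i; rewrite !mxE /seq_of /=.
  have im : (i <= m)%N by rewrite -ltnS (leq_trans (ltn_ord i)).
  by rewrite im mxE inordK.
have cQ p : W p -> {for p, continuous Q}.
  move=> Wp.
  have da := differentiable_continuous (smooth_differentiable (imm_smooth_a himm) Wp).
  have db := differentiable_continuous (smooth_differentiable (imm_smooth_b himm) Wp).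
  have dc := differentiable_continuous (smooth_differentiable (imm_smooth_c himm) Wp).
  have Vp : V (trunc n.+2 (seq_of p.2)).
    by apply: (imm_Vm_proj himm); rewrite seq_ofK; case: Wp.
  have cf : {for p, continuous f}.
    apply: (@continuous_comp _ _ _ (fun p : E => trunc n.+2 (seq_of p.2)) (f11 w)).
      apply: (@continuous_comp _ _ _ (snd : E -> _) (fun y => trunc n.+2 (seq_of y))).
        exact: cvg_snd.
      exact: trunc_seq_of_continuous.
    exact: differentiable_continuous (smooth_differentiable (pss_smooth_f11 hpss) Vp).
  apply: cvgD.
    apply: cvgD; first by apply: cvgM => //; apply: cvgM.
    by apply: cvgM => //; apply: cvgM => //; exact: cvg_cst.
  by apply: cvgM => //; exact: cvg_cst.
have Ep : ((x, t), y) = ((x, t), trunc m (seq_of y)) by rewrite seq_ofK.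
have nW' p : W' p -> \forall p' \near p, W' p' by move: oW'; rewrite openE => oW' /oW'.
have [[[x1 t1] y1] [W1 Q1]] : exists p, W' p /\ Q p != 0.
  apply: contrapT => nQ; have := nW' _ W'p; rewrite Ep => /nbhs_box[rho rho0 hin].
  have hinW : inside W x t (seq_of y) rho by split=> // *; apply: W'W; apply: hin.
  have [hKZ hi] := imm_box hinW; have [xx tt zz] := inside_center hinW.
  apply: (no_asymptotic_x eta0 hp hKZ hi _ xx tt zz) => x' t' z' Xx Tt Kz.
  have : Q ((x', t'), trunc m z') = 0.
    apply: contrapT => /eqP Q0; apply: nQ; exists ((x', t'), trunc m z').
    by split=> //; apply: hin.
  by rewrite /Q fE -expr2.
have : \forall p \near ((x1, t1), y1), W' p /\ Q p != 0.
  by apply: filterS2 (nW' _ W1) (cvgr_neq0 _ (cQ _ (W'W _ W1)) Q1) => p.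
have -> : ((x1, t1), y1) = ((x1, t1), trunc m (seq_of y1)) by rewrite seq_ofK.
move=> /nbhs_box[rho rho0 hin]; exists x1, t1, (seq_of y1), rho.
split; first by split=> // x' t' z' Xx Tt Kz; have [] := hin x' t' z' Xx Tt Kz.
have hinW : inside W x1 t1 (seq_of y1) rho.
  by split=> // x' t' z' Xx Tt Kz; apply: W'W; have [] := hin x' t' z' Xx Tt Kz.
have [hKZ hi] := imm_box hinW.
apply: (bi_universal eta0 hp hKZ hi) => x' t' z' Xx Tt Kz.
by have [_] := hin x' t' z' Xx Tt Kz; rewrite /Q fE -expr2.
Qed.

Lemma imm_W_nonempty : W !=set0.
Proof.
have [[x t] Op] := imm_Omega_nonempty himm; have [y Vy] := imm_Vm_nonempty himm.
by exists ((x, t), y).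
Qed.

(** One point suffices: each of the groups II to V imposes its condition at every point of V, so it
    can be refuted at this one. *)
Lemma imm_direction : exists z lam, [/\ V (trunc n.+2 z), lam ^+ 2 = 1,
  pd 0 (f11 w) (trunc n.+2 z) != 0,
  pd 0 (f31 w) (trunc n.+2 z) = lam * pd 0 (f11 w) (trunc n.+2 z) &
  f31 w (trunc n.+2 z) = lam * f11 w (trunc n.+2 z)].
Proof.
have [x0 [t0 [z0 [rho [hin d0]]]]] :=
  imm_locally_universal imm_open (fun _ => id) imm_W_nonempty.
have [hKZ hi] := imm_box hin; have [xx tt zz] := inside_center hin.
have [lam l1 hl] := universal_direction eta0 hp hKZ hi d0 xx tt zz.
have [h1 h2 h3] := hl z0 zz; rewrite !par_trunc // in h1 h2.
by exists z0, lam; split=> //; apply: hKZ.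
Qed.

End Immersion.

(** * Group I has the exceptional form; the other groups admit no immersion *)

Section Classification.
Context {R : realType} (n : nat) (eta : R) (V : set 'rV[R]_n.+3)
  (F : 'rV[R]_n.+3 -> R) (w : oneforms R n.+2).
Hypothesis eta0 : eta != 0.
Hypothesis hpss : describes_pss eta V F w.
Let hp := describes_pss_seq hpss.

Lemma nbhs_trunc_box (k : nat) (A : set 'rV[R]_k.+1) (z : nat -> R) :
  nbhs (trunc k z) A ->
  exists2 rho : R, 0 < rho & forall z', zbox k z rho z' -> A (trunc k z').
Proof.
move=> /nbhs_ballP[rho /= rho0 hA]; exists rho => // z' Kz; apply: hA.
exact/trunc_ball.
Qed.

Lemma group_I_exceptional y0 : V y0 -> group_I V w ->
  exists eps beta, exceptional eta V F w eps beta.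
Proof.
move=> Vy0 [lam [l1 hI]].
have lam0 : lam != 0.
  by apply/eqP => l0; move: l1; rewrite l0 expr0n => /eqP; rewrite eq_sym oner_eq0.
have hV z : V (trunc n.+2 z) -> tfun (f31 w) z = lam * tfun (f11 w) z by case/hI.
have hl z : V (trunc n.+2 z) -> par 0 (tfun (f31 w)) z = lam * par 0 (tfun (f11 w)) z.
  move=> Vz; rewrite -(parZ _ (sp_f hp (i := 0%N) Vz)); apply: par_near => //.
  by apply: filterS (sp_open hp Vz 0%N) => s /hV.
have f0 z : V (trunc n.+2 z) -> par 0 (tfun (f11 w)) z != 0.
  move=> Vz; apply/eqP => f0; have := sp_nonconst hp Vz.
  by rewrite hl // f0 mulr0 expr0n addr0 eqxx.
have local z : V (trunc n.+2 z) ->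
    tfun (f32 w) z = lam * tfun (f12 w) z /\
    exists2 rho : R, 0 < rho & dep 0 (zbox n.+2 z rho) (tfun (f22 w)).
  move=> Vz; have := pss_open hpss; rewrite openE => /(_ _ Vz)/nbhs_trunc_box[rho rho0 hK].
  have oK := @zbox_copen R n.+2 z rho.
  have hlK z' Kz := hl z' (hK z' Kz).
  have hmK z' : zbox n.+2 z rho z' -> tfun (f31 w) z' = lam * tfun (f11 w) z' - 0.
    by move=> Kz; rewrite subr0 hV //; apply: hK.
  have dg := skew_dep hp hK hlK.
  have vg := skew_vfield hp hK hlK hmK.
  have pg i z' : zbox n.+2 z rho z' ->
      pdiff i (fun z => tfun (f32 w) z - lam * tfun (f12 w) z) z'.
    by move=> Kz; apply: (pdiff_skew hp hK).
  have g0 : forall z', zbox n.+2 z rho z' -> tfun (f32 w) z' - lam * tfun (f12 w) z' = 0.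
    have dg0 := zbox_eigen_const dg pg (c := lam * eta).
    have {}dg0 : dep 0 (zbox n.+2 z rho) (fun z => tfun (f32 w) z - lam * tfun (f12 w) z).
      by apply: dg0 => z' Kz; rewrite vg // l1; ring.
    (* A constant g has D_x g = 0, which leaves lam eta g = 0. *)
    move=> z' Kz; have := vg z' Kz; rewrite (vfield_dep_trunc _ oK dg0 Kz) // l1.
    rewrite /vfield big_ord0 => e; have le0 : lam * eta != 0 by rewrite mulf_neq0.
    by apply: (mulfI le0); rewrite mulr0 [RHS]e; ring.
  have zz : zbox n.+2 z rho z by move=> i _; rewrite subrr normr0.
  split; first by apply/eqP; rewrite -subr_eq0 g0.
  exists rho => //.
  (* With f_31 = lam f_11 and f_32 = lam f_12 the second structure equation reads D_x f_22 = 0, an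
     eigenvalue equation with c = 0. *)
  apply: (@zbox_eigen_const _ n.+2 z rho n.+1 _ 0).
  - exact: dep_sub hK (sp_depr hp).
  - by move=> i z' /hK; apply: (sp_r hp).
  move=> z' Kz; rewrite (sp_eq2 hp (hK _ Kz)) mul0r.
  have -> : tfun (f32 w) z' = lam * tfun (f12 w) z' by apply/eqP; rewrite -subr_eq0 g0.
  by rewrite hV; [ring|apply: hK].
have r_const y : V y -> f22 w y = f22 w y0.
  move=> Vy; apply: (connected_locally_constant (pss_open hpss) (pss_connected hpss)) => //.
  move=> y' Vy'; rewrite -(seq_ofK y') in Vy' *.
  have [_ [rho rho0 d0]] := local _ Vy'.
  apply/nbhs_ballP; exists rho => //= y2; rewrite -(seq_ofK y2) => /trunc_ball => /(_ rho0) K2.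
  apply: (d0 _ _ K2) => //.
  by move=> i _; rewrite subrr normr0.
exists lam, (f22 w y0); split.
  have : (lam - 1) * (lam + 1) == 0 by rewrite -subr_sqr l1 expr1n subrr.
  by rewrite mulf_eq0 subr_eq0 addr_eq0 => /orP[] /eqP; [left|right].
move=> y Vy; rewrite -(seq_ofK y) in Vy *; set z := seq_of y in Vy *.
have f'0 := f0 z Vy; have [g0 _] := local z Vy; have h0 := hV z Vy.
have F0 := sp_order hp Vy; have e1 := sp_eq1 hp Vy; have pp := sp_par_p hp Vy.
rewrite par_trunc // in f'0; rewrite !par_trunc // in e1 pp F0.
split.
- exact/eqP.
- by rewrite pp; apply/eqP; rewrite mulf_neq0.
- by split=> //; apply: r_const.
- apply: (mulfI f'0); rewrite mulrA mulfV // mul1r shift_sum_trunc //.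
  move: e1 g0 h0; rewrite /tfun => -> -> ->; rewrite (r_const _ Vy); ring.
Qed.

Lemma not_exceptional_no_immersion : classified V w ->
  ~ (exists eps beta, exceptional eta V F w eps beta) ->
  forall m (Omega : set (R * R)) (Vm : set 'rV[R]_m.+1) a b c,
    ~ finite_jet_immersion eta V F w Omega Vm a b c.
Proof.
move=> hc hne m Omega Vm a b c himm.
have [z [lam [Vz l1 f0 hl hh]]] := imm_direction eta0 hpss himm.
(* L = H = 0 at this point, which each of the groups III, IV and V forbids; in group II the constant
   would have to equal lam. *)
have L0 : fL w (trunc n.+2 z) = 0 by rewrite /fL hl hh; ring.
have H0 : fH w (trunc n.+2 z) = 0.
  rewrite /fH hl hh.
  have -> : f11 w (trunc n.+2 z) * pd 0 (f11 w) (trunc n.+2 z) -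
    lam * f11 w (trunc n.+2 z) * (lam * pd 0 (f11 w) (trunc n.+2 z)) =
    (1 - lam ^+ 2) * (f11 w (trunc n.+2 z) * pd 0 (f11 w) (trunc n.+2 z)) by ring.
  by rewrite l1 subrr mul0r.
case: hc => [hI|[[lam' [l2 hII]]|[[hIII _]|[hIV|hV]]]].
- by apply: hne; apply: group_I_exceptional Vz hI.
- have [_ e1 ne] := hII _ Vz; apply: l2.
  have f1 : f11 w (trunc n.+2 z) != 0.
    by apply/eqP => f1; apply: ne; rewrite f1 mulr0.
  have -> : lam' = lam by apply: (mulIf f1); rewrite -e1.
  exact: l1.
- by have [_] := hIII _ Vz.
- by have [] := hIV _ Vz.
- by apply: (hV _ Vz); rewrite L0 mulr0.
Qed.

End Classification.

(** * The exceptional form *)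

Lemma gauss_sqr (R : realType) (u v w : R) : u * w - v ^+ 2 = -1 -> v * v = u * w + 1.
Proof. by move=> h; rewrite -expr2; lra. Qed.

Section ExceptionalForm.
Context {R : realType} (n m : nat) (eta eps beta : R) (V : set 'rV[R]_n.+3)
  (F : 'rV[R]_n.+3 -> R) (w : oneforms R n.+2).
Context (Omega : set (R * R)) (Vm : set 'rV[R]_m.+1) (a b c : R * R * 'rV[R]_m.+1 -> R).
Local Notation E := ((R * R) * 'rV[R]_m.+1)%type.
Hypothesis eta0 : eta != 0.
Hypothesis hpss : describes_pss eta V F w.
Hypothesis hexc : exceptional eta V F w eps beta.
Hypothesis himm : finite_jet_immersion eta V F w Omega Vm a b c.
Implicit Types (g : E -> R) (y : 'rV[R]_m.+1).

Let W : set E := Omega `*` Vm.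
Let hp := describes_pss_seq hpss.
Let oW : open W := imm_open himm.

Let ex : E := ((1, 0), 0).
Let et : E := ((0, 1), 0).
Let ez (i : nat) : E := ((0, 0), delta_mx 0 (inord i)).

(** Reduces a continuous identity on all of W to the centres of universal boxes, which are dense. *)
Let zero_of_universal g : (forall p, W p -> {for p, continuous g}) ->
  (forall x t z rho, inside W x t z rho -> universal_on a b c x t z rho ->
    g ((x, t), trunc m z) = 0) ->
  forall p, W p -> g p = 0.
Proof.
move=> cg hg; apply: (continuous_zero_dense oW cg) => W' oW' W'W W'0.
have [x [t [z [rho [hin d0]]]]] := imm_locally_universal eta0 hpss himm oW' W'W W'0.
have [xx tt zz] := inside_center hin; case: (hin) => rho0 hin'.
exists ((x, t), trunc m z); first exact: hin'.
by apply: (hg x t z rho) => //; split=> // x' t' z' Xx Tt Kz; apply: W'W; apply: hin'.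
Qed.

Let continuous_smooth g p : smooth_on W g -> W p -> {for p, continuous g}.
Proof. by move=> sg Wp; apply: differentiable_continuous (smooth_differentiable sg Wp). Qed.

Let universal_center x t z rho : inside W x t z rho -> universal_on a b c x t z rho ->
  let p := ((x, t), trunc m z) in
  [/\ 'D_ex a p = eps * eta * (a p - c p), 'D_et a p = eps * beta * (a p - c p),
      'D_ex b p = 2 * eps * eta * b p & 'D_et b p = 2 * eps * beta * b p].
Proof.
move=> hin d0; have [xx tt zz] := inside_center hin.
have [hKZ hi] := imm_box himm hin.
have ue := universal_eqs_of_imm hi d0 xx tt zz.
rewrite !dx_derive !dt_derive in ue.
have hf0 z' (Kz : zbox m z rho z') := ue_df_neq0 eta0 hp hKZ ue Kz.
have hV z' : V (trunc n.+2 z') ->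
    [/\ tfun (f31 w) z' = eps * tfun (f11 w) z', tfun (f32 w) z' = eps * tfun (f12 w) z' &
        tfun (f22 w) z' = beta].
  by move=> Vz; have [_ _ []] := hexc.2 _ Vz.
have hlam z' : zbox m z rho z' -> par 0 (tfun (f31 w)) z' = eps * par 0 (tfun (f11 w)) z'.
  move=> /hKZ Vz; rewrite -(parZ _ (sp_f hp (i := 0%N) Vz)); apply: par_near => //.
  by apply: filterS (sp_open hp Vz 0%N) => s /hV[].
have hmu z' : zbox m z rho z' -> tfun (f31 w) z' = eps * tfun (f11 w) z' - 0.
  by move=> /hKZ/hV[-> _ _]; rewrite subr0.
have [ea eb] := ue_dx hp hKZ hf0 hlam hmu zz ue.
(* With g = 0 and r = beta the first reduced equation is affine in f, with coefficients constant on
   the box. As f' <> 0, both coefficients vanish, which gives the t-derivatives of a and b. *)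
have H z' : zbox m z rho z' ->
  (eta * 'D_et b (x, t, trunc m z) - 2 * eps * eta * b (x, t, trunc m z) * beta)
  + ('D_et a (x, t, trunc m z)
     - eps * beta * (a (x, t, trunc m z) - c (x, t, trunc m z))) * tfun (f11 w) z' = 0.
  move=> Kz; have [e _] := ue_reduced hp hKZ hf0 hlam hmu zz ue Kz.
  have [_ e2 e3] := hV z' (hKZ _ Kz); rewrite e2 e3 in e.
  by apply: etrans e; rewrite /jet_of_xtz; ring.
have df z' : zbox m z rho z' -> pdiff 0 (tfun (f11 w)) z' by move=> /hKZ; apply: (sp_f hp).
have [e1 e2] := zbox_lin0 zz df hf0 H.
rewrite /= /ex /et; split.
- by rewrite ea /jet_of_xtz; ring.
- by apply/eqP; rewrite -subr_eq0 e2.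
- by rewrite eb /jet_of_xtz; ring.
- apply: (mulfI eta0); apply/eqP; rewrite -subr_eq0; apply/eqP.
  by apply: etrans e1; ring.
Qed.

Let sa := imm_smooth_a himm.
Let sb := imm_smooth_b himm.
Let sc := imm_smooth_c himm.

Let exceptional_equations p : W p ->
  [/\ 'D_ex a p = eps * eta * (a p - c p), 'D_et a p = eps * beta * (a p - c p),
      'D_ex b p = 2 * eps * eta * b p & 'D_et b p = 2 * eps * beta * b p].
Proof.
have cD g v (k : R) h p' : smooth_on W g -> {for p', continuous h} -> W p' ->
    {for p', continuous (fun p => 'D_v g p - k * h p)}.
  move=> sg ch Wp; apply: cvgB; first exact: (continuous_smooth (smooth_derive v sg)).
  by apply: cvgM => //; exact: cvg_cst.
have cac p' : W p' -> {for p', continuous (fun p => a p - c p)}.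
  by move=> Wp; apply: cvgB; apply: continuous_smooth.
have cb p' : W p' -> {for p', continuous b} by exact: continuous_smooth.
move=> Wp; split; apply/eqP; rewrite -subr_eq0; apply/eqP; move: p Wp.
- apply: zero_of_universal => [p Wp|x t z rho hin /(universal_center hin)[-> _ _ _]].
    by apply: cD => //; apply: cac.
  by rewrite subrr.
- apply: zero_of_universal => [p Wp|x t z rho hin /(universal_center hin)[_ -> _ _]].
    by apply: cD => //; apply: cac.
  by rewrite subrr.
- apply: zero_of_universal => [p Wp|x t z rho hin /(universal_center hin)[_ _ -> _]].
    by apply: cD => //; apply: cb.
  by rewrite subrr.
- apply: zero_of_universal => [p Wp|x t z rho hin /(universal_center hin)[_ _ _ ->]].
    by apply: cD => //; apply: cb.
  by rewrite subrr.
Qed.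

(** Vanishing of the z-derivatives extends from the universal boxes to W by continuity; g is then
    locally constant in z, and [Vm] is connected. *)
Let jet_const g x t y y' : smooth_on W g ->
  (forall x t z rho, inside W x t z rho -> universal_on a b c x t z rho ->
    dep 0 (zbox m z rho) (jet_of_xtz g x t)) ->
  Omega (x, t) -> Vm y -> Vm y' -> g ((x, t), y) = g ((x, t), y').
Proof.
move=> sg dg Oxt Vy Vy'.
have Dg0 i p : (i <= m)%N -> W p -> 'D_(ez i) g p = 0.
  move=> im; move: p; apply: zero_of_universal => [p Wp|x0 t0 z rho hin d0].
    exact: (continuous_smooth (smooth_derive (ez i) sg)).
  rewrite -par_derive //; have [_ _ zz] := inside_center hin.
  by rewrite (par_dep0 (@zbox_copen R m z rho) (dg _ _ _ _ hin d0)).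
apply: (connected_locally_constant (f := fun y => g ((x, t), y))
  (imm_Vm_open himm) (imm_Vm_connected himm)) Vy Vy' => y0 Vy0.
have : nbhs ((x, t), y0) W by move: oW; rewrite openE; apply; split.
rewrite -(seq_ofK y0) => /nbhs_box[rho rho0 hK].
have xx : `|x - x| < rho by rewrite subrr normr0.
have tt : `|t - t| < rho by rewrite subrr normr0.
have d0 : dep 0 (zbox m (seq_of y0) rho) (jet_of_xtz g x t).
  apply: (@zbox_dep0 _ m _ rho m.+1); first exact: jet_dep.
  move=> i z im Kz; split; last by rewrite par_derive // Dg0 //; apply: hK.
  have [_ _] := jet_diff_smooth (X := xball x rho) (T := xball t rho) sg hK xx tt Kz.
  exact.
apply/nbhs_ballP; exists rho => //= y2; rewrite -(seq_ofK y2) => /trunc_ball => /(_ rho0) K2.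
apply: (d0 _ _ K2) => // i _.
by rewrite subrr normr0.
Qed.

Let is_derive_x g x t y : smooth_on W g -> W ((x, t), y) ->
  is_derive x 1 (fun s => g ((s, t), y)) ('D_ex g ((x, t), y)).
Proof.
move=> sg Wp.
have hc s : ((s + x, t), y) = s *: ex + ((x, t), y) :> E.
  by congr ((_, _), _); rewrite /= ?scaler0 ?add0r // [s *: 1]mulr1.
rewrite -(@derive1_line _ E g (fun s => ((s, t), y)) x ex hc).
apply/is_derive_derive1/(@derivable_line _ E g (fun s => ((s, t), y)) x ex hc).
exact/diff_derivable/(smooth_differentiable sg).
Qed.

Let is_derive_t g x t y : smooth_on W g -> W ((x, t), y) ->
  is_derive t 1 (fun s => g ((x, s), y)) ('D_et g ((x, t), y)).
Proof.
move=> sg Wp.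
have hc s : ((x, s + t), y) = s *: et + ((x, t), y) :> E.
  by congr ((_, _), _); rewrite /= ?scaler0 ?add0r // [s *: 1]mulr1.
rewrite -(@derive1_line _ E g (fun s => ((x, s), y)) t et hc).
apply/is_derive_derive1/(@derivable_line _ E g (fun s => ((x, s), y)) t et hc).
exact/diff_derivable/(smooth_differentiable sg).
Qed.

Let xt_const (u : R -> R -> R) x t x' t' :
  (forall x t, Omega (x, t) -> is_derive x 1 (u ^~ t) 0 /\ is_derive t 1 (u x) 0) ->
  Omega (x, t) -> Omega (x', t') -> u x t = u x' t'.
Proof.
move=> du Oxt Oxt'.
apply: (connected_locally_constant (f := fun p => u p.1 p.2) (p := (x, t)) (q := (x', t'))
  (imm_Omega_open himm) (imm_Omega_connected himm)) Oxt Oxt' => -[x0 t0] O0 /=.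
have : nbhs (x0, t0) Omega by have := imm_Omega_open himm; rewrite openE; apply.
move=> /nbhs_ballP[rho /= rho0 hO]; apply/nbhs_ballP; exists rho => //= -[x1 t1] [/= hx ht].
have O x2 t2 : `|x2 - x0| < rho -> `|t2 - t0| < rho -> Omega (x2, t2).
  by move=> h1 h2; apply: hO; split; rewrite /ball /= distrC.
have c0 (v : R) : `|v - v| < rho by rewrite subrr normr0.
rewrite /ball /= distrC in hx; rewrite /ball /= distrC in ht.
rewrite (@derive1_0_const _ (u ^~ t1) x0 rho x1 x0) //; last first.
  move=> s hs; have [d _] := du _ _ (O _ _ hs ht).
  by split; [apply: ex_derive|apply: derive1_is_derive].
rewrite (@derive1_0_const _ (u x0) t0 rho t1 t0) //.
move=> s hs; have [_ d] := du _ _ (O _ _ (c0 x0) hs).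
by split; [apply: ex_derive|apply: derive1_is_derive].
Qed.

Local Notation ph x t := (2 * eps * (eta * x + beta * t)).

Let is_derive_exp_x (x t : R) : is_derive x 1 (fun s : R => expR (- (ph s t)))
  (- (2 * eps * eta) * expR (- (ph x t))).
Proof.
have d : is_derive x 1 (fun s : R => - (ph s t)) (- (2 * eps * eta)).
  have -> : (fun s : R => - (ph s t)) =
      fun s => (- (2 * eps * eta)) * s + (- (2 * eps * beta * t)).
    by apply/funext => s; ring.
  apply: is_derive_eq (is_deriveD (is_deriveM (is_derive_cst (- (2 * eps * eta) : R) x 1)
    (is_derive_id x 1)) (is_derive_cst (- (2 * eps * beta * t) : R) x 1)) _.
  by rewrite /GRing.scale /=; ring.
apply: is_derive_eq (is_derive1_comp (is_derive_expR _) d) _.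
by rewrite /GRing.scale /=; ring.
Qed.

Let is_derive_exp_t (x t : R) : is_derive t 1 (fun s : R => expR (- (ph x s)))
  (- (2 * eps * beta) * expR (- (ph x t))).
Proof.
have d : is_derive t 1 (fun s : R => - (ph x s)) (- (2 * eps * beta)).
  have -> : (fun s : R => - (ph x s)) =
      fun s => (- (2 * eps * beta)) * s + (- (2 * eps * eta * x)).
    by apply/funext => s; ring.
  apply: is_derive_eq (is_deriveD (is_deriveM (is_derive_cst (- (2 * eps * beta) : R) t 1)
    (is_derive_id t 1)) (is_derive_cst (- (2 * eps * eta * x) : R) t 1)) _.
  by rewrite /GRing.scale /=; ring.
apply: is_derive_eq (is_derive1_comp (is_derive_expR _) d) _.
by rewrite /GRing.scale /=; ring.
Qed.

Let gauss x t y : W ((x, t), y) ->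
  a ((x, t), y) * c ((x, t), y) - b ((x, t), y) ^+ 2 = -1.
Proof.
move=> [Oxt Vy]; have Vy' : Vm (trunc m (seq_of y)) by rewrite seq_ofK.
by have [_ _] := imm_eqs himm Oxt Vy'; rewrite /jet_of_xtz seq_ofK.
Qed.

Let b_law y : Vm y -> exists B, forall x t, Omega (x, t) ->
  b ((x, t), y) = B * expR (ph x t).
Proof.
move=> Vy; have [[xs ts] Os] := imm_Omega_nonempty himm.
exists (b ((xs, ts), y) * expR (- (ph xs ts))) => x t Oxt.
rewrite (@xt_const (fun x t => b ((x, t), y) * expR (- (ph x t))) xs ts x t) //.
  by rewrite -mulrA -expRD addNr expR0 mulr1.
move=> {}x {}t {}Oxt; have Wp : W ((x, t), y) by [].
have [_ _ e1 e2] := exceptional_equations Wp; split.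
  apply: is_derive_eq (is_deriveM (is_derive_x sb Wp) (is_derive_exp_x x t)) _.
  by rewrite e1 /GRing.scale /=; ring.
apply: is_derive_eq (is_deriveM (is_derive_t sb Wp) (is_derive_exp_t x t)) _.
by rewrite e2 /GRing.scale /=; ring.
Qed.

(** Along s = eta x + beta t one has a' = eps (a - c) and b' = 2 eps b. By the Gauss equation a a' =
    eps (a^2 - b^2 + 1), so adding b b' = 2 eps b^2 gives (a^2 + b^2 + 1)' = 2 eps (a^2 + b^2 +
    1). *)
Let a_law y : Vm y -> exists C, forall x t, Omega (x, t) ->
  a ((x, t), y) ^+ 2 + b ((x, t), y) ^+ 2 + 1 = C * expR (ph x t).
Proof.
move=> Vy; have [[xs ts] Os] := imm_Omega_nonempty himm.
pose u x t := a ((x, t), y) * a ((x, t), y) + b ((x, t), y) * b ((x, t), y) + 1.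
exists (u xs ts * expR (- (ph xs ts))) => x t Oxt.
rewrite (@xt_const (fun x t => u x t * expR (- (ph x t))) xs ts x t) //.
  by rewrite -mulrA -expRD addNr expR0 mulr1 /u !expr2.
move=> {}x {}t {}Oxt; have Wp : W ((x, t), y) by [].
have [a1 a2 e1 e2] := exceptional_equations Wp.
have G : b ((x, t), y) * b ((x, t), y) = a ((x, t), y) * c ((x, t), y) + 1.
  exact: gauss_sqr (gauss Wp).
split.
  have dax := is_derive_x sa Wp; have dbx := is_derive_x sb Wp.
  have du := is_deriveD (is_deriveD (is_deriveM dax dax) (is_deriveM dbx dbx))
    (is_derive_cst (1 : R) x 1).
  apply: is_derive_eq (is_deriveM du (is_derive_exp_x x t)) _.
  rewrite a1 e1 /GRing.scale /= !fctE.
  apply: etrans (_ : expR (- (ph x t)) * (2 * eps * eta) *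
    (b ((x, t), y) * b ((x, t), y) - a ((x, t), y) * c ((x, t), y) - 1) = 0); first by ring.
  by rewrite G; ring.
have dat := is_derive_t sa Wp; have dbt := is_derive_t sb Wp.
have du := is_deriveD (is_deriveD (is_deriveM dat dat) (is_deriveM dbt dbt))
  (is_derive_cst (1 : R) t 1).
apply: is_derive_eq (is_deriveM du (is_derive_exp_t x t)) _.
rewrite a2 e2 /GRing.scale /= !fctE.
apply: etrans (_ : expR (- (ph x t)) * (2 * eps * beta) *
  (b ((x, t), y) * b ((x, t), y) - a ((x, t), y) * c ((x, t), y) - 1) = 0); first by ring.
by rewrite G; ring.
Qed.

Let eps0 : eps != 0.
Proof. by case: hexc.1 => ->; rewrite ?oppr_eq0 oner_eq0. Qed.

(* Where a vanishes, a^2 = - (e/e_0 - 1)^2 with e = exp(2 eps (eta x + beta t)). *)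
Let a_neq0 x t y : W ((x, t), y) -> a ((x, t), y) != 0.
Proof.
move=> Wp; apply/eqP => a0; case: (Wp) => Oxt Vy.
have [B hB] := b_law Vy; have [C hC] := a_law Vy.
have G : b ((x, t), y) ^+ 2 = 1.
  by have := gauss Wp; rewrite a0 mul0r sub0r => /oppr_inj.
have [s sx Os] : exists2 s, s != x & Omega (s, t).
  apply: near_exists_neq.
  have : nbhs (x, t) Omega by have := imm_Omega_open himm; rewrite openE; apply.
  move=> /nbhs_ballP[rho /= rho0 hO]; apply/nbhs_ballP; exists rho => //= s hs.
  by apply: hO; split=> //=; exact: ballxx.
set e0 := expR (ph x t); set e := expR (ph s t).
have e00 : e0 != 0 by rewrite gt_eqF // expR_gt0.
have h1 := hC x t Oxt; have h2 := hC s t Os; rewrite a0 G expr0n /= -/e0 in h1.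
rewrite (hB s t Os) -/e in h2.
have h3 : (B * e0) ^+ 2 = 1 by rewrite -(hB x t Oxt).
have C2 : C = 2 / e0 by apply: (mulIf e00); rewrite divfK // -h1 add0r.
have h4 : (e0 * a ((s, t), y)) ^+ 2 + (e - e0) ^+ 2 = 0.
  have -> : (e0 * a ((s, t), y)) ^+ 2 + (e - e0) ^+ 2 =
    e0 ^+ 2 * (a ((s, t), y) ^+ 2 + (B * e) ^+ 2 + 1) - e ^+ 2 * ((B * e0) ^+ 2 - 1)
    - 2 * e * e0 by ring.
  by rewrite h2 h3 C2; field.
have [_ /eqP] := sqrD_eq0 h4; rewrite subr_eq0 => /eqP/expR_inj.
have ee0 : 2 * eps * eta != 0 by rewrite !mulf_neq0 // pnatr_eq0.
move=> h5; move/eqP: sx; apply; apply: (mulfI ee0); lra.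
Qed.

(** A continuous function without zeros has locally constant sign. The two first integrals determine
    only a^2, and sigma selects the root on all of Omega. *)
Let a_sign y : Vm y -> exists sigma, forall x t, Omega (x, t) ->
  Num.sg (a ((x, t), y)) = sigma.
Proof.
move=> Vy; have [[xs ts] Os] := imm_Omega_nonempty himm.
exists (Num.sg (a ((xs, ts), y))) => x t Oxt.
apply: (connected_locally_constant (f := fun q => Num.sg (a (q, y))) (p := (x, t))
  (imm_Omega_open himm) (imm_Omega_connected himm)) Oxt Os => q Oq.
have Wq : W (q, y) by [].
have ca : (fun q => a (q, y)) @ q --> a (q, y).
  apply: (@continuous_comp _ _ _ (fun q => (q, y) : E) a).
    move=> A [[P Q] [/= nP nQ] PQ]; apply: filterS nP => q' Pq'; apply: PQ.
    by split=> //; exact: nbhs_singleton nQ.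
  exact: continuous_smooth.
have : a (q, y) != 0 by case: q Oq Wq {ca} => x1 t1 _; apply: a_neq0.
rewrite neq_lt => /orP[] h.
  have H := cvgr_lt _ ca _ h; near=> q'; rewrite !ltr0_sg //.
  by near: q'; exact: H.
have H := cvgr_gt _ ca _ h; near=> q'; rewrite !gtr0_sg //.
by near: q'; exact: H.
Unshelve. all: by end_near. Qed.

Lemma exceptional_universal : exists phi_a phi_b phi_c : R -> R,
  forall x t y, Omega (x, t) -> Vm y ->
    [/\ a ((x, t), y) = phi_a (eta * x + beta * t),
        b ((x, t), y) = phi_b (eta * x + beta * t) &
        c ((x, t), y) = phi_c (eta * x + beta * t)].
Proof.
have [y0 Vy0] := imm_Vm_nonempty himm.
have [B hB] := b_law Vy0; have [C hC] := a_law Vy0; have [sigma hs] := a_sign Vy0.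
pose phi_b s := B * expR (2 * eps * s).
(* The law of a^2 + b^2 + 1 solved for a; below, c comes from the Gauss equation, divided by a <>
   0. *)
pose phi_a s := sigma * Num.sqrt (C * expR (2 * eps * s) - phi_b s ^+ 2 - 1).
exists phi_a, phi_b, (fun s => (phi_b s ^+ 2 - 1) / phi_a s) => x t y Oxt Vy.
have ey g : smooth_on W g ->
  (forall x t z rho, inside W x t z rho -> universal_on a b c x t z rho ->
    dep 0 (zbox m z rho) (jet_of_xtz g x t)) -> g ((x, t), y) = g ((x, t), y0).
  by move=> sg dg; apply: (jet_const sg dg).
have ea : a ((x, t), y) = a ((x, t), y0).
  by apply: ey sa _ => x1 t1 z rho /inside_center[xx tt _] /(_ _ _ xx tt)[].
have eb : b ((x, t), y) = b ((x, t), y0).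
  by apply: ey sb _ => x1 t1 z rho /inside_center[xx tt _] /(_ _ _ xx tt)[].
have hb : b ((x, t), y) = phi_b (eta * x + beta * t) by rewrite eb hB.
have ha : a ((x, t), y) = phi_a (eta * x + beta * t).
  rewrite /phi_a -hb -hC // -eb -ea.
  rewrite (_ : _ - _ - 1 = a ((x, t), y) ^+ 2); last by ring.
  by rewrite sqrtr_sqr -(hs x t Oxt) -ea -numEsg.
split=> //; rewrite -ha -hb.
have Wp : W ((x, t), y) by []; have a0 := a_neq0 Wp.
apply: (mulfI a0); rewrite [RHS]mulrC divfK //.
by rewrite expr2 (gauss_sqr (gauss Wp)) addrK.
Qed.

End ExceptionalForm.

Theorem theorem1 (R : realType) (k : nat) (eta : R) (V : set 'rV[R]_k.+1)
    (F : 'rV[R]_k.+1 -> R) (w : oneforms R k)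
    (hk : (2 <= k)%N) (heta : eta <> 0)
    (hpss : describes_pss eta V F w) (hclass : classified V w) :
  (~ (exists eps beta : R, exceptional eta V F w eps beta) ->
   ~ (exists (m : nat) (Omega : set (R * R)) (Vm : set 'rV[R]_m.+1)
        (a b c : R * R * 'rV[R]_m.+1 -> R),
        finite_jet_immersion eta V F w Omega Vm a b c)) /\
  (forall eps beta : R, exceptional eta V F w eps beta ->
   forall (m : nat) (Omega : set (R * R)) (Vm : set 'rV[R]_m.+1)
     (a b c : R * R * 'rV[R]_m.+1 -> R),
     finite_jet_immersion eta V F w Omega Vm a b c ->
     exists phi_a phi_b phi_c : R -> R,
       forall (x t : R) (z : 'rV[R]_m.+1), Omega (x, t) -> Vm z ->
         [/\ a ((x, t), z) = phi_a (eta * x + beta * t),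
             b ((x, t), z) = phi_b (eta * x + beta * t) &
             c ((x, t), z) = phi_c (eta * x + beta * t)]).
Proof.
case: k hk V F w hpss hclass => [|[|n]] // _ V F w hpss hclass.
have eta0 : eta != 0 by apply/eqP.
split=> [hne [m [D [Vm [a [b [c himm]]]]]]|eps beta hexc m Omega Vm a b c himm].
  exact: (not_exceptional_no_immersion eta0 hpss hclass hne himm).
exact: (exceptional_universal eta0 hpss hexc himm).
Qed.
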